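(* If a $C^1$ map $f:M\to M$ is such that $\inf_{x\in M}\|Df(x)\|>0$ and for every $f$-invariant probability measure $\mu$ we have $\chi(x)<0$ for $\mu$-a.e. $x\in M$, then there exists a unique periodic attracting orbit $\mathcal{O}_f(p)$ of $f$, and its basin is $M$.
   Context: $M$ is a connected compact $d$-dimensional manifold, $d\ge 2$, endowed with a Riemannian metric inducing a norm $\|\cdot\|$ on the tangent bundle (and operator norms) and a distance $\operatorname{dist}$ on $M$. The largest asymptotic growth rate is $$\chi(x)=\lim_{n\to+\infty}\frac1n\ln\|Df^n(x)\|,$$ which exists (in $[-\infty,\infty)$) for $\mu$-a.e. $x$ for each $f$-invariant probability measure $\mu$. A point $p$ belongs to a periodic orbit (with period $\tau$) if $f^\tau p=p$ for some $\tau\in\mathbb{Z}^+$ (not required to be minimal). The periodic orbit $\mathcal{O}_f(p)=\{p,fp,\dots,f^{\tau-1}p\}$ is attracting (a sink) if there is a neighborhood $V_p$ of $p$ such that $f^\tau|_{V_p}:V_p\to V_p$ is a contraction (there is $0<\lambda<1$ with $\operatorname{dist}(f^\tau q,f^\tau r)<\lambda\operatorname{dist}(q,r)$ for all distinct $q,r\in V_p$; equivalently $\|Df^\tau(p)\|<\lambda$ for some $\lambda\in(0,1)$). Its basin is $\{x\in M:\omega(x)=\mathcal{O}_f(p)\}$, where $\omega(x)$ is the set of accumulation points of $(f^nx)_{n\ge0}$. *)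

(* Defs.v *)
From HB Require Import structures.
From mathcomp Require Import all_boot all_order all_algebra.
From mathcomp Require Import all_classical all_reals all_analysis.

Set Implicit Arguments.
Unset Strict Implicit.
Unset Printing Implicit Defensive.

Import Order.TTheory GRing.Theory Num.Theory.
Import numFieldNormedType.Exports.

Local Open Scope classical_set_scope.
Local Open Scope ring_scope.

(* [Ck k U f] is meant for an open set U, so that the values of f outside U
   are irrelevant. In finite dimension, continuity of all the directional
   derivatives is continuity of the differential. *)
Fixpoint Ck (R : realType) (V W : normedModType R) (k : nat) (U : set V)
    (f : V -> W) : Prop :=
  match k with
  | 0 => forall x, U x -> {for x, continuous f}
  | k'.+1 => (forall x, U x -> differentiable f x) /\
             (forall v, Ck k' U (fun x => 'D_v f x))
  end.

Definition smooth (R : realType) (V W : normedModType R) (U : set V)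
  (f : V -> W) : Prop := forall k, Ck k U f.

(* [param] is the inverse of [coord]; both are total functions, of which only
   the values on [dom] and on [coord @` dom] matter. *)
Record chart (R : realType) (d : nat) (M : topologicalType) := Chart {
  dom : set M;
  coord : M -> 'rV[R]_d;
  param : 'rV[R]_d -> M;
  open_dom : open dom;
  open_codom : open (coord @` dom);
  coordK : forall x, dom x -> param (coord x) = x;
  continuous_coord : forall x, dom x -> {for x, continuous coord};
  continuous_param : forall x, dom x -> {for coord x, continuous param} }.

Record smooth_structure (R : realType) (d : nat) (M : topologicalType) :=
  SmoothStructure {
  atlas : set (chart R d M);
  atlas_cover : forall x, exists2 c, atlas c & dom c x;
  smooth_transition : forall c c', atlas c -> atlas c' ->
    smooth (coord c @` (dom c `&` dom c')) (coord c' \o param c) }.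

(* [gram c x] is the Gram matrix at x of the metric in the coordinate frame
   of the chart c. *)
Record riemannian_metric (R : realType) (d : nat) (M : topologicalType)
    (S : smooth_structure R d M) := RiemannianMetric {
  gram : chart R d M -> M -> 'M[R]_d;
  smooth_gram : forall c, atlas S c ->
    smooth (coord c @` dom c) (gram c \o param c);
  gram_sym : forall c x, atlas S c -> dom c x -> (gram c x)^T = gram c x;
  gram_pos : forall c x (v : 'rV[R]_d), atlas S c -> dom c x -> v != 0 ->
    0 < (v *m gram c x *m v^T) 0 0;
  gram_transition : forall c c' x (u v : 'rV[R]_d),
    atlas S c -> atlas S c' -> dom c x -> dom c' x ->
    let D := 'd (coord c' \o param c) (coord c x) in
    (D u *m gram c' x *m (D v)^T) 0 0 = (u *m gram c x *m v^T) 0 0 }.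

Section Riemannian.
Variables (R : realType) (d : nat) (M : topologicalType).
Variables (S : smooth_structure R d M) (g : riemannian_metric S).

Definition C1_map (f : M -> M) : Prop :=
  continuous f /\
  forall c c', atlas S c -> atlas S c' ->
    Ck 1 (coord c @` (dom c `&` f @^-1` dom c')) (coord c' \o f \o param c).

Definition C1_curve (gamma : R -> M) : Prop :=
  continuous gamma /\
  forall c, atlas S c ->
    Ck 1 (gamma @^-1` dom c : set R^o) (coord c \o gamma : R^o -> 'rV[R]_d).

(* The tangent space at x is identified with 'rV[R]_d through the chart
   [chart_at x]; by [gram_transition], [op_norm] and [speed] do not depend on
   the choice of these charts. *)
Definition chart_at (x : M) : chart R d M := s2val (cid2 (atlas_cover S x)).

Definition tangent_norm (x : M) (v : 'rV[R]_d) : R :=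
  Num.sqrt ((v *m gram g (chart_at x) x *m v^T) 0 0).

Definition tangent_map (f : M -> M) (x : M) : 'rV[R]_d -> 'rV[R]_d :=
  'd (coord (chart_at (f x)) \o f \o param (chart_at x)) (coord (chart_at x) x).

Definition op_norm (f : M -> M) (x : M) : R :=
  sup [set tangent_norm (f x) (tangent_map f x v) |
       v in [set v | tangent_norm x v <= 1]].

Definition speed (gamma : R -> M) (t : R) : R :=
  tangent_norm (gamma t)
    (derive1 (coord (chart_at (gamma t)) \o gamma : R -> 'rV[R]_d) t).

Definition curve_length (gamma : R -> M) : R :=
  Rintegral lebesgue_measure `[0, 1] (speed gamma).

(* [piecewise_C1 p q l]: some piecewise C^1 curve of length l goes from p to q.
   Each piece is the restriction to [0, 1] of a C^1 curve defined on the whole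
   line; every C^1 curve on [0, 1] (one-sided derivatives at the ends) is of
   this form. *)
Inductive piecewise_C1 : M -> M -> R -> Prop :=
| piecewise_C1_refl p : piecewise_C1 p p 0
| piecewise_C1_cons gamma q l : C1_curve gamma ->
    piecewise_C1 (gamma 1) q l ->
    piecewise_C1 (gamma 0) q (curve_length gamma + l).

Definition dist (p q : M) : R := inf [set l | piecewise_C1 p q l].

(* The sequence whose limit is chi(x); [lne] is the extended logarithm, with
   [lne 0 = -oo]. *)
Definition growth (f : M -> M) (x : M) (n : nat) : \bar R :=
  ((n%:R^-1)%:E * lne (op_norm (iter n f) x)%:E)%E.

Definition chi (f : M -> M) (x : M) : \bar R := limn (growth f x).

Definition orbit (f : M -> M) (p : M) (tau : nat) : set M :=
  [set iter k f p | k in `I_tau].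

Definition attracting (f : M -> M) (p : M) (tau : nat) : Prop :=
  exists2 V : set M, nbhs p V &
    (forall q, V q -> V (iter tau f q)) /\
    exists lambda : R, [/\ 0 < lambda, lambda < 1 &
      forall q r, V q -> V r -> q <> r ->
        dist (iter tau f q) (iter tau f r) < lambda * dist q r].

(* As tau need not be the minimal period, different pairs (p, tau) may give
   the same orbit; an orbit is thus a set of points. *)
Definition attracting_periodic_orbit (f : M -> M) (O : set M) : Prop :=
  exists p tau, [/\ (0 < tau)%N, iter tau f p = p, attracting f p tau &
    O = orbit f p tau].

Definition omega_limit (f : M -> M) (x : M) : set M :=
  cluster ((fun n => iter n f x) @ \oo).

Definition basin (f : M -> M) (O : set M) : set M :=
  [set x | omega_limit f x = O].

End Riemannian.

Definition borel (M : ptopologicalType) := g_sigma_algebraType (@open M).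

Definition invariant_measure (R : realType) (M : ptopologicalType)
    (f : M -> M) (mu : probability (borel M) R) : Prop :=
  forall A : set (borel M), measurable A -> mu (f @^-1` A) = mu A.

(* Main.v *)
From Pilot Require Import Defs.
From HB Require Import structures.
From mathcomp Require Import all_boot all_order all_algebra.
From mathcomp Require Import all_classical all_reals all_analysis.
From mathcomp Require Import ring lra.
Import Order.TTheory GRing.Theory Num.Theory.
Import numFieldNormedType.Exports.
(* Otherwise [coord] and [orbit] would be those of linear algebra and of finite
   graphs. *)
Import Pilot.Defs.
Local Open Scope classical_set_scope.
Local Open Scope ring_scope.

(** The hypothesis on [chi] is a statement about almost every point; the first
    half of the proof turns it into a uniform one: some iterate [iter N f],
    with [N > 0], has derivative of norm less than 1 everywhere
    ([negative_growth_uniform]). Otherwise, for each [n > 0] there is a point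
    [x n] at which the derivative of [iter n f] has norm at least 1. The averages
    of the Dirac masses along the first [n] points of the orbit of [x n] have a
    limit along an ultrafilter, and this limit is an invariant probability
    ([exists_invariant_limit], the construction of Krylov and Bogolyubov). For
    this probability the growth rate is negative almost everywhere, so for some
    large [N] the norm of the derivative of [iter N f] is at most [expR (- N a)]
    on an open set of probability more than one half, and less than 1 on an
    open set whose complement is as small as wanted compared with [a]
    ([exists_block]). For infinitely many [n], the proportions of time that the
    orbit of [x n] spends in these two sets obey the same lower bounds; since
    the norm of the derivative is submultiplicative, cutting this orbit into
    blocks of length [N] ([cocycle_average]) gives norm less than 1 at [x n], a
    contradiction.

    The limit probability is built directly on sets. The ultrafilter limit of
    the averages is a finitely additive probability [lam] on all subsets of the
    manifold; inner regularization by closed sets followed by outer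
    regularization by open sets makes it an outer measure for which open sets
    are measurable ([exists_regularization]). On open sets the result is at most
    [lam]; this inequality carries lower bounds for the probability of an open
    set back to the orbits.

    The second half is a contraction argument for [h = iter N f]. By
    compactness the norm of its derivative is bounded by some [k < 1], so [h]
    multiplies lengths of curves, hence distances, by at most [k]
    ([dist_comp_le]); the distances are infima over nonempty sets because the
    manifold is connected ([connected_piecewise_C1]). The Riemannian distance
    is compared with the topology in one direction only: distinct points have
    neighborhoods at positive distance from each other
    ([piecewise_C1_lower_bound]), because a bump function supported in a chart
    is Lipschitz with respect to length ([bump_piecewise]). A cluster point of
    an orbit of [h] is a fixed point of [h], it is the only one, hence it is
    fixed by [f], and all orbits of [f] converge to it ([exists_fixpoint],
    [cvg_orbit], [cluster_set1]). So every periodic orbit is this fixed point,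
    and the whole manifold is its basin. *)

Set Implicit Arguments.
Unset Strict Implicit.
Unset Printing Implicit Defensive.

(** * Calculus of C1 maps at a point *)

Lemma eq_near_diff (R : realType) (V W : normedModType R) (f g : V -> W) (x : V) :
  (\near x, f x = g x) -> differentiable f x ->
  differentiable g x /\ 'd g x = 'd f x :> (V -> W).
Proof.
move=> fg dfx; have fgx := nbhs_singleton fg.
have cdf : continuous ('d f x) by apply: diff_continuous.
have E : g \o shift x = cst (g x) + 'd f x +o_ 0 id.
  apply/eqaddoP => e e0.
  have /diff_locally := dfx; move=> /eqaddoP/(_ e e0).
  have := fg; rewrite (near_shift 0) /=; apply: filterS2 => h /= fgh.
  by rewrite !fctE /= /shift /= -fgx; move: fgh; rewrite subr0 => ->.
have D := diff_unique cdf E.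
split=> //; apply/diff_locallyP; split; first by rewrite D.
by rewrite D.
Unshelve. all: by end_near. Qed.

Lemma eq_near_continuous (T U : topologicalType) (f g : T -> U) t :
  (\near t, f t = g t) -> {for t, continuous f} -> {for t, continuous g}.
Proof.
move=> fg cf; rewrite /prop_for /continuous_at.
have <- := nbhs_singleton fg.
have fg' : {near t, f =1 g} by [].
exact: cvg_trans (near_eq_cvg fg') cf.
Qed.

(** The form of [Ck 1] that composes: it is local, and an arbitrary function
    may be replaced by any other one with the same germ. *)
Definition C1_at (R : realType) (V W : normedModType R) (f : V -> W) (x : V) :=
  (\near x, differentiable f x) /\
  forall v, {for x, continuous (fun y => 'D_v f y)}.

Section C1.
Variable R : realType.
Implicit Types V W : normedModType R.

Lemma Ck1P V W (U : set V) (f : V -> W) : open U ->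
  Ck 1 U f <-> forall x, U x -> C1_at f x.
Proof.
move=> oU; split=> [[df Df] x Ux|H].
  split; last by move=> v; apply: (Df v).
  have : nbhs x U by apply: open_nbhs_nbhs.
  by apply: filterS => y Uy; exact: df.
split=> [x /H[/nbhs_singleton]//|v x /H[_]]; exact.
Qed.

Lemma C1_at_diff V W (f : V -> W) x : C1_at f x -> differentiable f x.
Proof. by case=> /nbhs_singleton. Qed.

Lemma C1_at_continuous V W (f : V -> W) x : C1_at f x -> {for x, continuous f}.
Proof. by move=> /C1_at_diff/differentiable_continuous. Qed.

Lemma eq_near_C1_at V W (f g : V -> W) x :
  (\near x, f x = g x) -> C1_at f x -> C1_at g x.
Proof.
move=> fg [df Df]; have fg2 := near_join fg; split.
  near=> y; have /eq_near_diff[] // : \forall z \near y, f z = g z by near: y.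
  by near: y.
move=> v; refine (eq_near_continuous _ (Df v)).
near=> y; apply: near_eq_derive; near: y; exact: fg2.
Unshelve. all: by end_near. Qed.

(** In finite dimension, continuity of the directional derivatives one vector
    at a time gives joint continuity in the point and in the vector, by
    expanding the vector in the canonical basis. *)
Lemma continuous_diff_pair W (T : topologicalType) d (psi : 'rV[R]_d -> W)
    (phi : T -> 'rV[R]_d) (w : T -> 'rV[R]_d) t :
  C1_at psi (phi t) -> {for t, continuous phi} -> {for t, continuous w} ->
  {for t, continuous (fun s => 'd psi (phi s) (w s))}.
Proof.
move=> [dpsi Dpsi] cphi cw.
pose h s := \sum_(i < d) w s 0 i *: 'D_('e_i) psi (phi s).
  have dps : \forall s \near t, differentiable psi (phi s) by exact: cphi _ dpsi.
have E : \forall s \near t, h s = 'd psi (phi s) (w s).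
  apply: filterS dps => s ds.
  rewrite [in RHS](row_sum_delta (w s)) linear_sum; apply: eq_bigr => i _.
  by rewrite linearZ/= deriveE.
refine (eq_near_continuous E _).
rewrite /h; apply: cvg_big => [|i _]; first exact: add_continuous.
apply: cvgZ.
  exact: (@continuous_comp _ _ _ w (fun M : 'rV[R]_d => M 0 i) t cw
    (@coord_continuous _ _ _ _ _ _)).
exact: (@continuous_comp _ _ _ phi ('D_('e_i) psi) t cphi (Dpsi _)).
Qed.

Lemma C1_at_comp V W d (psi : 'rV[R]_d -> W) (phi : V -> 'rV[R]_d) x :
  C1_at phi x -> C1_at psi (phi x) -> C1_at (psi \o phi) x.
Proof.
move=> Cphi Cpsi; have cphi := C1_at_continuous Cphi.
have [dphi Dphi] := Cphi; have [dpsi Dpsi] := Cpsi.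
have dpsi' : \forall s \near x, differentiable psi (phi s) by exact: cphi _ dpsi.
split.
  near=> y; apply: differentiable_comp; first by near: y.
  by near: y.
move=> v; have E : \forall y \near x, 
    'd psi (phi y) ('D_v phi y) = 'D_v (psi \o phi) y.
  near=> y.
  have d1 : differentiable phi y by near: y.
  have d2 : differentiable psi (phi y) by near: y.
  have d3 : differentiable (psi \o phi) y by exact: differentiable_comp.
  by rewrite (deriveE _ d1) (deriveE _ d3) (diff_comp d1 d2).
refine (eq_near_continuous E _).
exact: continuous_diff_pair.
Unshelve. all: by end_near. Qed.

End C1.

(** * Maps read in charts and the Riemannian norm *)

Section Charts.
Variables (R : realType) (d : nat) (M : topologicalType).
Variable (S : smooth_structure R d M).
Implicit Types (c : chart R d M) (f h : M -> M) (x : M).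

(** With [f := id] this is the change of coordinates of tangent vectors, so that
    the chain rule [cdiff_comp] also covers changes of charts. *)
Definition cdiff c c' f x : 'rV[R]_d -> 'rV[R]_d :=
  'd (coord c' \o f \o param c) (coord c x).

Lemma atlas_chart_at x : atlas S (chart_at S x).
Proof. by rewrite /chart_at; case: cid2. Qed.

Lemma dom_chart_at x : dom (chart_at S x) x.
Proof. by rewrite /chart_at; case: cid2. Qed.

Lemma near_dom c x : dom c x -> \forall y \near x, dom c y.
Proof. by move=> cx; apply: open_nbhs_nbhs; split=> //; exact: open_dom. Qed.

Lemma near_param c x : dom c x -> \forall y \near coord c x,
  dom c (param c y) /\ coord c (param c y) = y.
Proof.
move=> cx; have : nbhs (coord c x) (coord c @` dom c).
  by apply: open_nbhs_nbhs; split; [exact: open_codom|exists x].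
by apply: filterS => _ [z cz <-]; rewrite coordK.
Qed.

Lemma cvg_param c x : dom c x -> param c y @[y --> coord c x] --> x.
Proof. by move=> cx; have := continuous_param cx; rewrite /prop_for /continuous_at coordK. Qed.

Lemma open_coord_image c (A : set M) : open A -> open (coord c @` (dom c `&` A)).
Proof.
move=> oA; rewrite openE => _ [x [cx Ax] <-]; rewrite /interior.
have Ax' : nbhs x A by exact: open_nbhs_nbhs.
have := cvg_param cx Ax'; have := near_param cx.
apply: filterS2 => y [cy yE] Ay.
by exists (param c y).
Qed.

Lemma C1_map_at f c c' x : C1_map S f -> atlas S c -> atlas S c' ->
  dom c x -> dom c' (f x) -> C1_at (coord c' \o f \o param c) (coord c x).
Proof.
move=> [cf Df] Sc Sc' cx c'fx.
have oU : open (coord c @` (dom c `&` f @^-1` dom c')).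
  by apply: open_coord_image; move/continuousP: cf; apply; exact: open_dom.
have [H _] := Ck1P (coord c' \o f \o param c) oU.
by apply: (H (Df _ _ Sc Sc')); exists x.
Qed.


Lemma C1_map_id : C1_map S id.
Proof.
split; first by move=> x; exact: cvg_id.
by move=> c c' Sc Sc'; have /(_ 1%N) := smooth_transition Sc Sc'.
Qed.

(** Inserting an intermediate chart changes a composite only away from the
    point: this is what reduces statements about maps to calculus. *)
Lemma near_comp_charts f h c c' c'' x : continuous f ->
  dom c x -> dom c' (f x) ->
  \forall y \near coord c x,
   ((coord c'' \o h \o param c') \o (coord c' \o f \o param c)) y =
   (coord c'' \o (h \o f) \o param c) y.
Proof.
move=> cf cx c'fx.
have c'n : \forall z \near x, dom c' (f z) by exact: cf _ _ (near_dom c'fx).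
have c'p : \forall y \near coord c x, dom c' (f (param c y)) by exact: cvg_param cx _ c'n.
apply: filterS c'p => y /= c'fy.
by rewrite coordK.
Qed.

Lemma C1_map_comp f h : C1_map S f -> C1_map S h -> C1_map S (h \o f).
Proof.
move=> Cf Ch; have [cf _] := Cf; have [ch _] := Ch.
have chf : continuous (h \o f) by move=> x; apply: continuous_comp; [exact: cf|exact: ch].
split=> // c c'' Sc Sc''; apply/Ck1P.
  by apply: open_coord_image; move/continuousP: chf; apply; exact: open_dom.
move=> _ [x [cx c''x] <-]; set c' := chart_at S (f x).
have Sc' := atlas_chart_at (f x); have c'x := dom_chart_at (f x).
refine (eq_near_C1_at (near_comp_charts h c'' cf cx c'x) _).
apply: C1_at_comp; first exact: C1_map_at.
rewrite /= coordK//; exact: C1_map_at.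
Qed.

Lemma C1_map_iter f n : C1_map S f -> C1_map S (iter n f).
Proof.
move=> Cf; elim: n => [|n IH]; first exact: C1_map_id.
exact: (C1_map_comp IH Cf).
Qed.

Lemma cdiff_comp f h c c' c'' x v : C1_map S f -> C1_map S h ->
  atlas S c -> atlas S c' -> atlas S c'' ->
  dom c x -> dom c' (f x) -> dom c'' (h (f x)) ->
  cdiff c c'' (h \o f) x v = cdiff c' c'' h (f x) (cdiff c c' f x v).
Proof.
move=> Cf Ch Sc Sc' Sc'' cx c'x c''x; have [cf _] := Cf.
have d1 := C1_at_diff (C1_map_at Cf Sc Sc' cx c'x).
have d2 := C1_at_diff (C1_map_at Ch Sc' Sc'' c'x c''x).
have E : coord c' (f x) = (coord c' \o f \o param c) (coord c x) by rewrite /= coordK.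
rewrite E in d2.
set psi := coord c'' \o h \o param c' in d2 *.
set phi := coord c' \o f \o param c in d1 d2 E *.
have d3 := differentiable_comp d1 d2.
have [_ D] := eq_near_diff (near_comp_charts h c'' cf cx c'x) d3.
transitivity ('d (psi \o phi) (coord c x) v).
  exact: (congr1 (fun F : 'rV[R]_d -> 'rV[R]_d => F v) D).
transitivity ('d psi (phi (coord c x)) ('d phi (coord c x) v)).
  exact: (congr1 (fun F : 'rV[R]_d -> 'rV[R]_d => F v) (diff_comp d1 d2)).
exact: (congr1 (fun z => 'd psi z _) (esym E)).
Qed.

End Charts.

Section Metric.
Variables (R : realType) (d : nat) (M : topologicalType).
Variables (S : smooth_structure R d M) (g : riemannian_metric S).
Implicit Types (c : chart R d M) (f h : M -> M) (x : M).

Definition cnorm c x (v : 'rV[R]_d) : R := Num.sqrt ((v *m gram g c x *m v^T) 0 0).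

Lemma cnorm_transition c c' x v : atlas S c -> atlas S c' -> dom c x -> dom c' x ->
  cnorm c' x (cdiff c c' id x v) = cnorm c x v.
Proof.
by move=> Sc Sc' cx c'x; rewrite /cnorm; have /= <- := gram_transition g v v Sc Sc' cx c'x.
Qed.

Lemma tangent_normE c x v : atlas S c -> dom c x ->
  tangent_norm g x v = cnorm c x (cdiff (chart_at S x) c id x v).
Proof.
move=> Sc cx; rewrite cnorm_transition//; [exact: atlas_chart_at|exact: dom_chart_at].
Qed.

(** The left side uses the charts chosen at [x], which do not depend
    continuously on [x]; the right side uses charts fixed near [x]. Both come
    from reading [id \o f] and [f \o id] in charts. *)
Lemma tangent_norm_mapE f c c' x v : C1_map S f -> atlas S c -> atlas S c' ->
  dom c x -> dom c' (f x) ->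
  tangent_norm g (f x) (tangent_map S f x v) =
  cnorm c' (f x) (cdiff c c' f x (cdiff (chart_at S x) c id x v)).
Proof.
move=> Cf Sc Sc' cx c'fx; rewrite (tangent_normE _ Sc' c'fx).
have Cid := C1_map_id S.
have Sx := atlas_chart_at S x; have Dx := dom_chart_at S x.
have Sfx := atlas_chart_at S (f x); have Dfx := dom_chart_at S (f x).
have E1 := cdiff_comp v Cf Cid Sx Sfx Sc' Dx Dfx c'fx.
have E2 := cdiff_comp v Cid Cf Sx Sc Sc' Dx cx c'fx.
exact: (congr1 (cnorm c' (f x)) (etrans (esym E1) E2)).
Qed.

Lemma continuous_cnorm (T : topologicalType) (phi : T -> M) (w : T -> 'rV[R]_d) c t :
  atlas S c -> dom c (phi t) -> {for t, continuous phi} -> {for t, continuous w} ->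
  {for t, continuous (fun s => cnorm c (phi s) (w s))}.
Proof.
move=> Sc ct cphi cw.
have cc : {for t, continuous (coord c \o phi)}.
  exact: continuous_comp cphi (continuous_coord ct).
have cG : {for t, continuous (fun s => gram g c (phi s))}.
  have ns : \forall s \near t, dom c (phi s) by exact: cphi _ (near_dom ct).
  have E : \forall s \near t, (gram g c \o param c) ((coord c \o phi) s) = gram g c (phi s).
    by apply: filterS ns => s cs /=; rewrite coordK.
  refine (eq_near_continuous E _).
  have := smooth_gram g Sc 0%N; move=> /(_ (coord c (phi t))) H.
  have {}H := H (ex_intro2 _ _ _ ct erefl).
  exact: (@continuous_comp _ _ _ (coord c \o phi) (gram g c \o param c) t cc H).
have cw' i : {for t, continuous (fun s => w s 0 i)}.
  exact: (@continuous_comp _ _ _ w (fun M : 'rV[R]_d => M 0 i) t cw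
    (@coord_continuous _ _ _ _ _ _)).
have cG' i j : {for t, continuous (fun s => gram g c (phi s) i j)}.
  exact: (@continuous_comp _ _ _ _ (fun M : 'M[R]_d => M i j) t cG
    (@coord_continuous _ _ _ _ _ _)).
rewrite /cnorm.
refine (@continuous_comp _ _ _ _ Num.sqrt t _ _); last exact: sqrt_continuous.
have E s : (w s *m gram g c (phi s) *m (w s)^T) 0 0 =
  \sum_j (\sum_i w s 0 i * gram g c (phi s) i j) * w s 0 j.
  by rewrite mxE; apply: eq_bigr => j _; rewrite !mxE.
rewrite (_ : (fun s => _) = fun s => \sum_j (\sum_i w s 0 i * gram g c (phi s) i j) * w s 0 j).
  apply: cvg_big => [|j _]; first exact: add_continuous.
  apply: cvgM; last exact: cw'.
  apply: cvg_big => [|i _]; first exact: add_continuous.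
  by apply: cvgM; [exact: cw'|exact: cG'].
by apply/funext => s; exact: E.
Qed.

Lemma cnorm_gt0 c x v : atlas S c -> dom c x -> v != 0 -> 0 < cnorm c x v.
Proof. by move=> Sc cx v0; rewrite sqrtr_gt0; apply: gram_pos. Qed.

Lemma cnormZ c x a v : cnorm c x (a *: v) = `|a| * cnorm c x v.
Proof.
rewrite /cnorm linearZ/= -scalemxAl -scalemxAr -scalemxAl scalerA mxE.
by rewrite -expr2 sqrtrM ?sqr_ge0// sqrtr_sqr.
Qed.

Lemma cnorm_ge0 c x v : 0 <= cnorm c x v.
Proof. exact: sqrtr_ge0. Qed.

Lemma cnorm0 c x : cnorm c x 0 = 0.
Proof. by rewrite /cnorm !mul0mx mxE sqrtr0. Qed.

End Metric.

(** * The operator norm of the derivative *)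

Section OpNorm.
Variables (R : realType) (d : nat) (M : topologicalType).
Variables (S : smooth_structure R d M) (g : riemannian_metric S).
Implicit Types (c : chart R d M) (f h : M -> M) (x : M).

Lemma compact_sphere : compact [set v : 'rV[R]_d | `|v| = 1].
Proof.
apply: bounded_closed_compact.
  by exists 1; split=> // r r1 v /= ->; exact: ltW.
have -> : [set v : 'rV[R]_d | `|v| = 1] = Num.norm @^-1` [set 1] by [].
by apply: closed_comp; [move=> x _; exact: norm_continuous|exact: closed_eq].
Qed.

(** Reduces inequalities between norms of tangent vectors to the compact unit
    sphere. *)
Lemma homogeneous_le (p q : 'rV[R]_d -> R) a :
  (forall k v, p (k *: v) = `|k| * p v) -> (forall k v, q (k *: v) = `|k| * q v) ->
  (forall v, `|v| = 1 -> p v <= a * q v) -> forall v, p v <= a * q v.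
Proof.
move=> pZ qZ H v; have [->|v0] := eqVneq v 0.
  by rewrite -(scale0r 0) pZ qZ normr0 !mul0r mulr0.
have nv : 0 < `|v| by rewrite normr_gt0.
have := H (`|v|^-1 *: v); rewrite pZ qZ normrZ normfV normr_id mulVf ?gt_eqF//.
by move=> /(_ erefl); rewrite mulrCA ler_pM2l// invr_gt0.
Qed.

Lemma tangent_normZ x a v : tangent_norm g x (a *: v) = `|a| * tangent_norm g x v.
Proof. exact: cnormZ. Qed.

Lemma tangent_norm_ge0 x v : 0 <= tangent_norm g x v.
Proof. exact: sqrtr_ge0. Qed.

Lemma tangent_norm_gt0 x v : v != 0 -> 0 < tangent_norm g x v.
Proof. by apply: cnorm_gt0; [exact: atlas_chart_at|exact: dom_chart_at]. Qed.

Lemma tangent_norm0 x : tangent_norm g x 0 = 0.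
Proof. exact: cnorm0. Qed.

Lemma tangent_mapZ f x a v : tangent_map S f x (a *: v) = a *: tangent_map S f x v.
Proof. by rewrite /tangent_map linearZ. Qed.

(** A strict inequality on the compact unit sphere persists nearby, uniformly
    on the sphere (tube lemma); it becomes large by homogeneity, which also
    covers the zero vector. *)
Lemma near_tangent_map_le f x0 a : C1_map S f -> 0 <= a ->
  (forall v, `|v| = 1 ->
    tangent_norm g (f x0) (tangent_map S f x0 v) < a * tangent_norm g x0 v) ->
  \forall x \near x0, forall v,
    tangent_norm g (f x) (tangent_map S f x v) <= a * tangent_norm g x v.
Proof.
move=> Cf a0 H; have [cf _] := Cf.
set c := chart_at S x0; set c' := chart_at S (f x0).
have Sc : atlas S c by exact: atlas_chart_at.
have cx : dom c x0 by exact: dom_chart_at.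
have Sc' : atlas S c' by exact: atlas_chart_at.
have cfx : dom c' (f x0) by exact: dom_chart_at.
have T : \forall x \near x0, forall v, `|v| = 1 ->
    cnorm g c' (f x) (cdiff c c' f x v) < a * cnorm g c x v.
  have /compact_near_coveringP K := compact_sphere.
  have := K M (nbhs x0) (fun x v =>
    cnorm g c' (f x) (cdiff c c' f x v) < a * cnorm g c x v) _.
  apply=> v v1.
  pose F (s : 'rV[R]_d * M) := a * cnorm g c s.2 s.1
    - cnorm g c' (f s.2) (cdiff c c' f s.2 s.1).
  have c1 : {for (v, x0), continuous (fst : 'rV[R]_d * M -> _)} by exact: cvg_fst.
  have c2 : {for (v, x0), continuous (snd : 'rV[R]_d * M -> _)} by exact: cvg_snd.
  have cfs : {for (v, x0), continuous (fun s : 'rV[R]_d * M => f s.2)}.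
    by apply: continuous_comp c2 _; exact: cf.
  have cF : {for (v, x0), continuous F}.
    apply: cvgB.
      apply: cvgM; first exact: cvg_cst.
      exact: (@continuous_cnorm _ _ _ _ g _ snd fst c (v, x0) Sc cx c2 c1).
    apply: (@continuous_cnorm _ _ _ _ g _ (fun s => f s.2)
      (fun s => cdiff c c' f s.2 s.1) c' (v, x0) Sc' cfx cfs).
    have cs : {for (v, x0), continuous (fun s : 'rV[R]_d * M => coord c s.2)}.
      by apply: continuous_comp c2 _; exact: continuous_coord.
    exact: (@continuous_diff_pair _ _ _ _ (coord c' \o f \o param c)
      (fun s : 'rV[R]_d * M => coord c s.2) fst (v, x0)
      (C1_map_at Cf Sc Sc' cx cfx) cs c1).
  have F0 : 0 < F (v, x0) by rewrite subr_gt0; exact: H.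
  have nF : \forall s \near (v, x0), 0 < F s by exact: (cvgr_gt _ cF _ F0).
  have : nbhs (v, x0) [set s | cnorm g c' (f s.2) (cdiff c c' f s.2 s.1)
      < a * cnorm g c s.2 s.1].
    by apply: filterS nF => s; rewrite subr_gt0.
  exact.
have nf : \forall x \near x0, dom c' (f x) by exact: cf _ _ (near_dom cfx).
near=> x => v.
have cx' : dom c x by near: x; exact: near_dom.
have cfx' : dom c' (f x) by near: x.
rewrite (tangent_norm_mapE g v Cf Sc Sc' cx' cfx') (tangent_normE g v Sc cx').
move: (cdiff _ _ _ _ v) => {v}.
apply: homogeneous_le => //.
- by move=> k v; rewrite /cdiff linearZ cnormZ.
- by move=> k v; rewrite cnormZ.
- move=> v v1; apply: ltW; move: v v1; near: x; exact: T.
Unshelve. all: by end_near. Qed.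

(** Makes the supremum defining [op_norm] meaningful: a ratio of norms is
    continuous on the unit sphere, hence bounded. *)
Lemma tangent_map_bound f x : C1_map S f -> exists2 a, 0 < a &
  forall v, `|v| = 1 ->
    tangent_norm g (f x) (tangent_map S f x v) < a * tangent_norm g x v.
Proof.
move=> Cf.
have [[v0 v01]|E] := pselect ([set v : 'rV[R]_d | `|v| = 1] !=set0); last first.
  by exists 1 => // v v1; case: E; exists v.
pose r v := tangent_norm g (f x) (tangent_map S f x v) / tangent_norm g x v.
have Sc := atlas_chart_at S x; have cx := dom_chart_at S x.
have Sc' := atlas_chart_at S (f x); have cx' := dom_chart_at S (f x).
have cr : {within [set v : 'rV[R]_d | `|v| = 1], continuous r}.
  apply: continuous_in_subspaceT => v; rewrite inE => v1.
  have cst_x (y : M) : {for v, continuous (fun _ : 'rV[R]_d => y)}.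
    exact: (@cst_continuous _ _ y v).
  have v0' : v != 0 by rewrite -normr_eq0 v1 oner_eq0.
  have cs : {for v, continuous (fun=> coord (chart_at S x) x)}.
    exact: (@cst_continuous _ _ _ v).
  have ct : {for v, continuous (tangent_map S f x)}.
    exact: (@continuous_diff_pair _ _ _ _
      (coord (chart_at S (f x)) \o f \o param (chart_at S x))
      (fun=> coord (chart_at S x) x) id v (C1_map_at Cf Sc Sc' cx cx') cs cvg_id).
  have cn : {for v, continuous (fun w => tangent_norm g (f x) (tangent_map S f x w))}.
    exact: (@continuous_cnorm _ _ _ _ g _ (fun=> f x) (tangent_map S f x)
      (chart_at S (f x)) v Sc' cx' (cst_x _) ct).
  have cd : {for v, continuous (tangent_norm g x)}.
    exact: (@continuous_cnorm _ _ _ _ g _ (fun=> x) id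
      (chart_at S x) v Sc cx (cst_x _) cvg_id).
  have n0 : tangent_norm g x v != 0 by rewrite gt_eqF// tangent_norm_gt0.
  exact: (cvgM cn (cvgV n0 cd)).
have [|w _ rw] := compact_EVT_max _ compact_sphere cr; first by exists v0.
exists (`|r w| + 1) => [|v v1]; first by rewrite ltr_pwDr.
rewrite -ltr_pdivrMr ?tangent_norm_gt0//; last by rewrite -normr_eq0 v1 oner_eq0.
apply: le_lt_trans (rw v _) _; first by rewrite inE.
by rewrite (le_lt_trans (ler_norm _))// ltrDl.
Qed.

Lemma has_sup_op_norm f x : C1_map S f ->
  has_sup [set tangent_norm g (f x) (tangent_map S f x v) |
       v in [set v | tangent_norm g x v <= 1]].
Proof.
move=> Cf; split.
  exists (tangent_norm g (f x) (tangent_map S f x 0)), 0 => //=.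
  by rewrite tangent_norm0.
have [a a0 H] := tangent_map_bound x Cf.
exists a => _ [v /= v1 <-].
have /nbhs_singleton := near_tangent_map_le Cf (ltW a0) H.
by move=> /(_ v) /le_trans; apply; rewrite ger_pMr.
Qed.

Lemma op_norm_ge0 f x : C1_map S f -> 0 <= op_norm g f x.
Proof.
move=> /has_sup_op_norm-/(_ x)[_ hs]; apply: le_trans (ub_le_sup hs _).
  exact: (tangent_norm_ge0 (f x) (tangent_map S f x 0)).
by exists 0 => //=; rewrite tangent_norm0.
Qed.

Lemma tangent_map_le f x v : C1_map S f ->
  tangent_norm g (f x) (tangent_map S f x v) <= op_norm g f x * tangent_norm g x v.
Proof.
move=> Cf; have [->|v0] := eqVneq v 0.
  by rewrite -(scale0r 0) tangent_mapZ !tangent_normZ normr0 !mul0r mulr0.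
have nv := tangent_norm_gt0 x v0.
rewrite -ler_pdivrMr//; apply: ub_le_sup; first by case: (has_sup_op_norm x Cf).
exists ((tangent_norm g x v)^-1 *: v).
  by rewrite /= tangent_normZ normfV gtr0_norm// mulVf ?gt_eqF.
by rewrite tangent_mapZ tangent_normZ normfV gtr0_norm// mulrC.
Qed.

Lemma op_norm_le f x a : C1_map S f -> 0 <= a ->
  (forall v, tangent_norm g (f x) (tangent_map S f x v) <= a * tangent_norm g x v) ->
  op_norm g f x <= a.
Proof.
move=> Cf a0 H; apply: ge_sup; first by case: (has_sup_op_norm x Cf).
by move=> _ [v /= v1 <-]; apply: le_trans (H v) _; rewrite ler_piMr.
Qed.

(** Upper semicontinuity: a bound that is slightly larger than the operator norm
    is strict on the unit sphere, hence persists nearby. *)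
Lemma near_op_norm_lt f x0 a : C1_map S f -> op_norm g f x0 < a ->
  \forall x \near x0, op_norm g f x < a.
Proof.
move=> Cf fa; pose b := (op_norm g f x0 + a) / 2.
have fb : op_norm g f x0 < b by rewrite midf_lt.
have ba : b < a by rewrite midf_lt.
have b0 : 0 <= b by rewrite (le_trans (op_norm_ge0 x0 Cf))// ltW.
have := @near_tangent_map_le f x0 b Cf b0.
have H v : `|v| = 1 ->
    tangent_norm g (f x0) (tangent_map S f x0 v) < b * tangent_norm g x0 v.
  move=> v1; apply: le_lt_trans (tangent_map_le _ _ Cf) _.
  by rewrite ltr_pM2r// tangent_norm_gt0// -normr_eq0 v1 oner_eq0.
move=> /(_ H); apply: filterS => x Hx.
exact: le_lt_trans (op_norm_le Cf b0 Hx) ba.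
Qed.

Lemma op_norm_comp f h x : C1_map S f -> C1_map S h ->
  op_norm g (h \o f) x <= op_norm g h (f x) * op_norm g f x.
Proof.
move=> Cf Ch; apply: op_norm_le; first exact: C1_map_comp.
  by rewrite mulr_ge0// op_norm_ge0.
move=> v; have -> : tangent_map S (h \o f) x v = tangent_map S h (f x) (tangent_map S f x v).
  by apply: (@cdiff_comp _ _ _ S); rewrite //; do ?exact: atlas_chart_at; exact: dom_chart_at.
apply: le_trans (tangent_map_le _ _ Ch) _.
by rewrite -mulrA ler_wpM2l ?op_norm_ge0// tangent_map_le.
Qed.

End OpNorm.

(** * From a finitely additive probability to a Borel probability *)

Section Regularization.
Variables (R : realType) (T : ptopologicalType) (lam : set T -> R).
Hypotheses (hT : hausdorff_space T) (cT : compact [set: T]).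
Hypothesis lam_ge0 : forall A, 0 <= lam A.
Hypothesis lamT : lam setT = 1.
Hypothesis lamU : forall A B, A `&` B = set0 -> lam (A `|` B) = lam A + lam B.

Lemma lam0 : lam set0 = 0.
Proof. by apply: (addrI (lam set0)); rewrite -lamU ?setI0// setU0 addr0. Qed.

Lemma le_lam A B : A `<=` B -> lam A <= lam B.
Proof.
move=> AB; rewrite -(setDUK AB) lamU; first by rewrite lerDl.
by rewrite setDE setICA setICr setI0.
Qed.

Lemma lamU_le A B : lam (A `|` B) <= lam A + lam B.
Proof.
have -> : A `|` B = A `|` (B `\` A) by rewrite setUDr setDv setD0.
rewrite lamU; first by rewrite lerD2l le_lam//; exact: subDsetl.
by rewrite setDE setICA setICr setI0.
Qed.

(** [lam] is only finitely additive. Approximating open sets by closed, hence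
    compact, sets from inside turns countable covers into finite ones. *)
Definition inner (U : set T) : R := sup (lam @` [set K | closed K /\ K `<=` U]).

Lemma lam_le_inner K U : closed K -> K `<=` U -> lam K <= inner U.
Proof.
move=> cK KU; apply: ub_le_sup; last by exists K.
by exists 1 => _ [A _ <-]; rewrite -lamT le_lam.
Qed.

Lemma inner_le U a : (forall K, closed K -> K `<=` U -> lam K <= a) -> inner U <= a.
Proof.
move=> H; apply: ge_sup; first by exists (lam set0), set0 => //; split=> //; exact: closed0.
by move=> _ [K [cK KU] <-]; exact: H.
Qed.

Lemma le_inner U V : U `<=` V -> inner U <= inner V.
Proof. by move=> UV; apply: inner_le => K cK KU; apply: lam_le_inner => // x /KU/UV. Qed.

Lemma inner_le_lam U : inner U <= lam U.
Proof. by apply: inner_le => K _; exact: le_lam. Qed.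

Lemma inner_ge0 U : 0 <= inner U.
Proof. by rewrite -lam0; apply: lam_le_inner => //; exact: closed0. Qed.

Definition outer (A : set T) : R := inf (inner @` [set U | open U /\ A `<=` U]).

Lemma outer_le_inner A U : open U -> A `<=` U -> outer A <= inner U.
Proof.
move=> oU AU; apply: ge_inf; last by exists U.
by exists 0 => _ [V _ <-]; exact: inner_ge0.
Qed.

Lemma le_outer_inner A a : (forall U, open U -> A `<=` U -> a <= inner U) -> a <= outer A.
Proof.
move=> H; apply: lb_le_inf; first by exists (inner setT), setT => //; split=> //; exact: openT.
by move=> _ [U [oU AU] <-]; exact: H.
Qed.

Lemma outer_open U : open U -> outer U = inner U.
Proof.
move=> oU; apply/eqP; rewrite eq_le outer_le_inner//=.
by apply: le_outer_inner => V _; exact: le_inner.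
Qed.

Lemma le_outer A B : A `<=` B -> outer A <= outer B.
Proof.
by move=> AB; apply: le_outer_inner => U oU BU; apply: outer_le_inner => // x /AB/BU.
Qed.

Lemma outer_ge0 A : 0 <= outer A.
Proof. by apply: le_outer_inner => U _ _; exact: inner_ge0. Qed.

Lemma outer0 : outer set0 = 0.
Proof.
apply/eqP; rewrite eq_le outer_ge0 andbT outer_open; last exact: open0.
by rewrite -lam0 inner_le_lam.
Qed.

Lemma outerT : outer setT = 1.
Proof.
rewrite outer_open; last exact: openT.
apply/eqP; rewrite eq_le -[X in _ <= X]lamT inner_le_lam/= -lamT.
by apply: lam_le_inner => //; exact: closedT.
Qed.

Lemma outer_adherent A e : 0 < e ->
  exists U, [/\ open U, A `<=` U & inner U < outer A + e].
Proof.
move=> e0; have [|_ [U [oU AU] <-] Ue] :=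
  @inf_adherent _ (inner @` [set U | open U /\ A `<=` U]) _ e0.
  split; first by exists (inner setT), setT => //; split=> //; exact: openT.
  by exists 0 => _ [V _ <-]; exact: inner_ge0.
by exists U.
Qed.

Lemma inner_adherent U e : 0 < e ->
  exists K, [/\ closed K, K `<=` U & inner U - e < lam K].
Proof.
move=> e0; have [|_ [K [cK KU] <-] Ke] :=
  @sup_adherent _ (lam @` [set K | closed K /\ K `<=` U]) _ e0.
  split; first by exists (lam set0), set0 => //; split=> //; exact: closed0.
  by exists 1 => _ [A _ <-]; rewrite -lamT le_lam.
by exists K.
Qed.

(** Normality of a compact Hausdorff space splits a closed set covered by two
    open sets into two closed pieces, one inside each. *)
Lemma lam_le_sum_inner (U : nat -> set T) n K : (forall i, open (U i)) -> closed K ->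
  K `<=` \bigcup_(i in `I_n) U i -> lam K <= \sum_(i < n) inner (U i).
Proof.
move=> oU; elim: n K => [|n IH] K cK KU.
  by rewrite big_ord0 -lam0; apply: le_lam => x /KU[].
pose W := \bigcup_(i in `I_n) U i.
have oW : open W by apply: bigcup_open.
have cKU : closed (K `\` U n) by apply: closedI => //; exact: open_closedC.
have KW : K `\` U n `<=` W.
  move=> x [/KU[i /= ni Uix] nUn]; exists i => //=.
  by move: ni; rewrite ltnS leq_eqVlt => /orP[/eqP ni|//]; move: nUn; rewrite -ni.
have nW : set_nbhs (K `\` U n) W by move=> x /KW Wx; exact: open_nbhs_nbhs.
have [C nC CW] := compact_normal hT cT cKU nW.
have KE : K `<=` (K `&` closure C) `|` (K `\` C^°).
  move=> x Kx; have [Cx|nCx] := pselect (C^° x); [left|right] => //.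
  by split=> //; apply: subset_closure; exact: interior_subset.
apply: le_trans (le_lam KE) _; apply: le_trans (lamU_le _ _) _.
rewrite big_ord_recr; apply: lerD.
  by apply: IH; [apply: closedI => //; exact: closed_closure|move=> x [_ /CW]].
apply: lam_le_inner; first by apply: closedI => //; apply: open_closedC; exact: open_interior.
by move=> x [Kx nCx]; apply: contrapT => nUx; apply: nCx; apply: nC.
Qed.

(** Countable subadditivity on open sets: a closed set inside the union is
    compact, so finitely many of the open sets already cover it. *)
Lemma inner_bigcup (U : nat -> set T) (a : \bar R) : (forall i, open (U i)) ->
  (forall n, ((\sum_(i < n) inner (U i))%:E <= a)%E) ->
  ((inner (\bigcup_i U i))%:E <= a)%E.
Proof.
move=> oU Ha.
have ha0 := Ha 0%N; rewrite big_ord0 in ha0.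
case: a Ha ha0 => [a| |//] Ha ha0; last by rewrite leey.
rewrite lee_fin; apply: inner_le => K cK KU.
have : compact K by exact: subclosed_compact cK cT _.
rewrite compact_cover => /(_ _ setT U (fun i _ => oU i) KU)[D _ KD].
pose n := (\max_(i <- finmap.enum_fset D) i).+1.
rewrite -lee_fin; apply: le_trans (Ha n); rewrite lee_fin.
apply: lam_le_sum_inner => // x /KD[i /= iD Ux]; exists i => //=.
by rewrite ltnS; apply: (@leq_bigmax_seq _ _ xpredT id).
Qed.

Definition outer_ereal (A : set T) : \bar R := (outer A)%:E.

Lemma outer_ereal_sigma_subadditive : sigma_subadditive outer_ereal.
Proof.
move=> F; apply/lee_addgt0Pr => e e0.
have He i : 0 < e / (2 ^ i.+1)%:R by rewrite divr_gt0// ltr0n expn_gt0.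
have /choice[U HU] : forall i, exists U,
    [/\ open U, F i `<=` U & inner U < outer (F i) + e / (2 ^ i.+1)%:R].
  by move=> i; exact: outer_adherent.
have oU i : open (U i) by case: (HU i).
have FU : \bigcup_n F n `<=` \bigcup_n U n.
  by move=> x [i _ Fx]; exists i => //; case: (HU i) => _ + _; apply.
apply: (@le_trans _ _ (inner (\bigcup_n U n))%:E).
  by rewrite lee_fin; apply: outer_le_inner => //; apply: bigcup_open.
apply: le_trans (epsilon_trick xpredT _ (ltW e0)); last by move=> n; rewrite lee_fin outer_ge0.
apply: inner_bigcup => // n.
apply: le_trans (nneseries_lim_ge n _); last first.
  by move=> i _ _; rewrite -EFinD lee_fin addr_ge0// ?outer_ge0// ltW.
rewrite big_mkord -sumEFin; apply: lee_sum => i _.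
by rewrite -EFinD lee_fin ltW//; case: (HU i).
Qed.

HB.instance Definition _ := isOuterMeasure.Build R T outer_ereal
  (congr1 EFin outer0) (fun A => outer_ge0 A : (0 <= outer_ereal A)%E)
  (fun A B AB => le_outer AB : (outer_ereal A <= outer_ereal B)%E)
  outer_ereal_sigma_subadditive.

(** Given an open [V] around the test set, first exhaust [V `&` U] by a closed
    [K], then [V `\` K] by a closed [L]; since [K] and [L] are disjoint,
    [lam K + lam L <= inner V]. *)
Lemma open_caratheodory U : open U -> outer_ereal.-caratheodory U.
Proof.
move=> oU; apply: (@le_caratheodory_measurable _ _ outer_ereal) => X.
rewrite -EFinD lee_fin; apply: le_outer_inner => V oV XV.
apply/ler_addgt0Pr => e e0.
have e2 : 0 < e / 2 by rewrite divr_gt0.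
have [K [cK KVU lK]] := inner_adherent (V `&` U) e2.
have oVK : open (V `\` K) by apply: openI => //; exact: closed_openC.
have [L [cL LVK lL]] := inner_adherent (V `\` K) e2.
have H1 : outer (X `&` U) <= inner (V `&` U).
  by apply: outer_le_inner; [exact: openI|move=> x [/XV]].
have H2 : outer (X `&` ~` U) <= inner (V `\` K).
  by apply: outer_le_inner => // x [/XV Vx nUx]; split=> // /KVU[].
have H3 : lam (K `|` L) <= inner V.
  by apply: lam_le_inner; [exact: closedU|move=> x [/KVU[]|/LVK[]]].
move: H3; rewrite lamU; last by apply/seteqP; split=> // x [Kx /LVK[_]].
move=> H3; rewrite (splitr e).
have := lerD H1 H2; have := ltW lK; have := ltW lL; move: H3; clear.
by move: (lam K) (lam L) (inner V) (inner _) (inner _) (outer _) (outer _) (e/2) => *; lra.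
Qed.

Lemma borel_caratheodory (A : set (borel T)) : measurable A -> outer_ereal.-caratheodory A.
Proof.
apply: (@smallest_sub _ (sigma_algebra setT) (@open T)); last first.
  by move=> U; exact: open_caratheodory.
split.
- exact: caratheodory_measurable_set0.
- by move=> B mB; rewrite setTD; exact: caratheodory_measurable_setC.
- by move=> F mF; exact: caratheodory_measurable_bigcup.
Qed.

Definition regularization : set (borel T) -> \bar R := outer_ereal.

Lemma regularization_sigma_additive : semi_sigma_additive regularization.
Proof.
move=> F mF tF mUF; apply: (@caratheodory_measure_sigma_additive _ _ outer_ereal) => //.
  by move=> i; exact: borel_caratheodory.
exact: borel_caratheodory.
Qed.

HB.instance Definition _ := isMeasure.Build _ (borel T) R regularization
  (congr1 EFin outer0) (fun A => outer_ge0 A : (0 <= outer_ereal A)%E)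
  regularization_sigma_additive.

HB.instance Definition _ := Measure_isProbability.Build _ (borel T) R regularization
  (congr1 EFin outerT).

Lemma exists_regularization : exists P : probability (borel T) R,
  forall A, P A = (outer A)%:E.
Proof. by exists regularization. Qed.

End Regularization.

(** * Invariant measures from orbit averages *)

(** Ultrafilters provide limits of averages for all sets simultaneously, which a
    choice of subsequences cannot do. *)
Lemma ultrafilter_cvg (R : realType) (I : Type) (F : set_system I) (u : I -> R) a b :
  UltraFilter F -> (\forall i \near F, a <= u i <= b) -> cvg (u i @[i --> F]).
Proof.
move=> FU uab; have FP : ProperFilter F by exact: ultra_proper.
have [l [_ Gl]] := @segment_compact R a b (u i @[i --> F]) _ uab.
apply/cvg_ex; exists l => /= B Bl.
have [//|nB] := in_ultra_setVsetC (u @^-1` B) FU.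
by have [y []] := Gl (~` B) B nB Bl.
Qed.

Section Birkhoff.
Variables (R : realType) (T : Type) (f : T -> T).

Definition birkhoff_avg (phi : T -> R) n x : R := n%:R^-1 * \sum_(k < n) phi (iter k f x).

Lemma birkhoff_avg_indic_itv A n x : 0 <= birkhoff_avg \1_A n x <= 1.
Proof.
rewrite /birkhoff_avg; case: n => [|n]; first by rewrite big_ord0 mulr0 lexx ler01.
have s0 : 0 <= \sum_(k < n.+1) (\1_A (iter k f x) : R).
  by apply: sumr_ge0 => k _; rewrite indicE ler0n.
rewrite mulr_ge0 ?invr_ge0 ?ler0n//= mulrC ler_pdivrMr ?ltr0n// mul1r.
have -> : n.+1%:R = \sum_(k < n.+1) (1 : R) by rewrite sumr_const card_ord.
by apply: ler_sum => k _; rewrite indicE; case: (_ \in _).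
Qed.

(** The sums telescope, so averages over [n] steps are invariant under [f] up
    to [1 / n]. *)
Lemma birkhoff_avg_preimage A n x :
  birkhoff_avg \1_(f @^-1` A) n x = birkhoff_avg \1_A n x +
    n%:R^-1 * (\1_A (iter n f x) - \1_A x).
Proof.
rewrite /birkhoff_avg -mulrDr; congr (_ * _).
have E k : \1_(f @^-1` A) (iter k f x) = \1_A (iter k.+1 f x) :> R by [].
under eq_bigr => k _ do rewrite E.
elim: n => [|n IH]; first by rewrite !big_ord0 subrr addr0.
by rewrite !big_ord_recr/= IH; lra.
Qed.

End Birkhoff.

Section KrylovBogolyubov.
Variables (R : realType) (T : ptopologicalType) (f : T -> T) (x : nat -> T).
Hypotheses (hT : hausdorff_space T) (cT : compact [set: T]) (cf : continuous f).

(** The averages are taken along orbits whose initial point [x n] varies with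
    [n]. For open sets the limit measure is bounded by the limit of the
    averages, which is one half of the portmanteau theorem. *)
Lemma exists_invariant_limit : exists (F : set_system nat) (P : probability (borel T) R),
  [/\ ProperFilter F, \oo `<=` F, invariant_measure f P &
   forall (U : set T) r, open U -> (r%:E < P U)%E ->
     \forall n \near F, r < birkhoff_avg f \1_U n (x n)].
Proof.
have [F [FU ooF]] := @ultraFilterLemma nat \oo _.
have FP : ProperFilter F by exact: ultra_proper.
pose u A n : R := birkhoff_avg f \1_A n (x n).
have cu A : cvg (u A n @[n --> F]).
  apply: (@ultrafilter_cvg R nat F (u A) 0 1) => //.
  by apply: nearW => n; exact: birkhoff_avg_indic_itv.
pose lam A := lim (u A n @[n --> F]).
have ulam A : u A n @[n --> F] --> lam A by exact: cu.
have n_gt0 : \forall n \near F, (0 < n)%N by apply: ooF; exact: nbhs_infty_gt.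
have lam_ge0 A : 0 <= lam A.
  apply: limr_ge => //; apply: nearW => n.
  by have /andP[] := birkhoff_avg_indic_itv R f A n (x n).
have lamT : lam setT = 1.
  apply: cvg_lim => //; apply: cvg_near_cst; apply: filterS n_gt0 => n n0.
  rewrite /u /birkhoff_avg (eq_bigr (fun=> 1)) => [|k _]; last by rewrite indicT.
  by rewrite sumr_const card_ord mulVf// pnatr_eq0 -lt0n.
have lamU A B : A `&` B = set0 -> lam (A `|` B) = lam A + lam B.
  move=> AB; apply: cvg_lim => //.
  have -> : u (A `|` B) = u A \+ u B.
    apply/funext => n; rewrite /u /birkhoff_avg /= -mulrDr -big_split; congr (_ * _).
    apply: eq_bigr => k _; rewrite /= !indicE in_setU.
    have [a|_] := boolP (_ \in A); have [b|_] := boolP (_ \in B); rewrite ?addr0 ?add0r//.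
    have : (A `&` B) (iter k f (x n)) by split; apply: set_mem.
    by rewrite AB.
  by apply: cvgD; exact: ulam.
have [P PE] := exists_regularization hT cT lam_ge0 lamT lamU.
exists F, P; split=> //; last first.
  move=> U r oU; rewrite PE (outer_open lam_ge0 lamT lamU oU) lte_fin => rU.
  apply: cvgr_gt (ulam U) _ _; apply: lt_le_trans rU _.
  exact: inner_le_lam.
have lam_pre A : lam (f @^-1` A) = lam A.
  apply: cvg_lim => //.
  have -> : u (f @^-1` A) = u A \+ (fun n => n%:R^-1 * (\1_A (iter n f (x n)) - \1_A (x n))).
    by apply/funext => n; rewrite /u birkhoff_avg_preimage.
  rewrite -[X in _ --> X]addr0; apply: cvgD; first exact: ulam.
  apply/cvgr0Pnorm_le => e e0; apply: ooF.
  near=> n.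
  have n0 : (0 < n)%N by near: n; exact: nbhs_infty_gt.
  rewrite normrM normfV normr_nat ler_pdivrMl ?ltr0n//.
  apply: (@le_trans _ _ 1).
    rewrite !indicE; case: (_ \in _); case: (_ \in _);
      by rewrite ?subrr ?subr0 ?sub0r ?normrN ?normr0 ?normr1.
  rewrite -ler_pdivrMr// div1r; near: n; exact: nbhs_infty_ger.
have P_le A : (P (f @^-1` A) <= P A)%E.
  rewrite !PE lee_fin; apply: le_outer_inner => // U oU AU.
  apply: (@le_trans _ _ (inner lam (f @^-1` U))).
    by apply: outer_le_inner => //; [move/continuousP: cf; exact|move=> y; exact: AU].
  apply: inner_le => // K cK KU.
  apply: (@le_trans _ _ (lam (f @^-1` (f @` K)))).
    by apply: le_lam => //; exact: preimage_image.
  rewrite lam_pre; apply: lam_le_inner => //; last by move=> _ [y /KU ? <-].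
  apply: compact_closed => //; apply: continuous_compact; first exact: continuous_subspaceT.
  exact: subclosed_compact cK cT _.
move=> A mA; apply/eqP; rewrite eq_le P_le/=.
have mfA : measurable (f @^-1` A : set (borel T)).
  have := @smallest_sub _ (sigma_algebra setT) open _
    (sigma_algebra_image f (@smallest_sigma_algebra _ setT (@open T))).
  move=> /(_ _ _ mA); rewrite /image_set_system/= setTI; apply=> U oU.
  by rewrite /= setTI; apply: sub_sigma_algebra; move/continuousP: cf; exact.
have := P_le (~` A); rewrite preimage_setC !probability_setC// => H.
move: H; rewrite !PE -!EFinB !lee_fin; lra.
Unshelve. all: by end_near. Qed.

End KrylovBogolyubov.

(** * Negative growth almost everywhere is uniform contraction *)

Lemma cvg_lt_near (R : realType) (u : nat -> \bar R) (l a : \bar R) :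
  u n @[n --> \oo] --> l -> (l < a)%E -> \forall n \near \oo, (u n < a)%E.
Proof.
move=> ul la; apply: (ul [set y | y < a]%E).
by apply: open_nbhs_nbhs; split => //; exact: open_ereal_lt_ereal.
Qed.

Lemma cvg_gt_near (R : realType) (u : nat -> \bar R) (l a : \bar R) :
  u n @[n --> \oo] --> l -> (a < l)%E -> \forall n \near \oo, (a < u n)%E.
Proof.
move=> ul la; apply: (ul [set y | a < y]%E).
by apply: open_nbhs_nbhs; split => //; exact: open_ereal_gt_ereal.
Qed.

(** Covers the case of a vanishing derivative, where the logarithm is [-oo]. *)
Lemma lne_lt_expR (R : realType) (a b : R) (n : nat) : (0 < n)%N ->
  (((n%:R^-1)%:E * lne b%:E) < a%:E)%E -> b < expR (n%:R * a).
Proof.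
move=> n0 /=; case: ifPn => [b0 _|]; first by rewrite (le_lt_trans b0)// expR_gt0.
rewrite -ltNge => b0; rewrite -EFinM lte_fin ltr_pdivrMl ?ltr0n// => H.
by rewrite -[b in b < _]lnK ?posrE// ltr_expR.
Qed.

Section Cocycle.
Variables (R : realType) (T : Type) (f : T -> T) (b : nat -> T -> R).
Hypothesis b_ge0 : forall n x, 0 <= b n x.
Hypothesis b0 : forall x, b 0%N x <= 1.
Hypothesis bD : forall n m x, b (n + m) x <= b n (iter m f x) * b m x.

Lemma cocycle_expR_le C : (forall x, b 1%N x <= expR C) ->
  forall n x, b n x <= expR (n%:R * C).
Proof.
move=> bC; elim=> [|n IH] x; first by rewrite mul0r expR0.
rewrite -addn1; apply: le_trans (bD _ _ _) _.
by rewrite natrD mulrDl mul1r expRD ler_pM.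
Qed.

Lemma cocycle_block_le N (s : T -> R) : (forall y, b N y <= expR (N%:R * s y)) ->
  forall q x, b (q * N) x <= expR (N%:R * \sum_(j < q) s (iter (j * N) f x)).
Proof.
move=> bs; elim=> [|q IH] x; first by rewrite big_ord0 mulr0 expR0 mul0n.
rewrite mulSn; apply: le_trans (bD _ _ _) _.
by rewrite big_ord_recr mulrDr [in leRHS]addrC expRD ler_pM.
Qed.

(** Every time [k < q * N] is uniquely [i + j * N]: summing over the [N]
    possible starting offsets of blocks of length [N] recovers the orbit. *)
Lemma sum_blocks N (s : T -> R) q x :
  \sum_(i < N) \sum_(j < q) s (iter (j * N) f (iter i f x)) =
  \sum_(k < q * N) s (iter k f x).
Proof.
elim: q => [|q IH]; first by rewrite mul0n !big_ord0 big1// => i _; rewrite big_ord0.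
under eq_bigr => i _ do rewrite big_ord_recr.
rewrite big_split/= IH mulSn addnC big_split_ord/=; congr (_ + _).
by apply: eq_bigr => i _; rewrite -iterD.
Qed.

(** If the block [N] grows at rate at most [s], then cutting the orbit into
    blocks of length [N] from each offset [i < N] bounds [b n x] in [N] ways.
    Averaging the [N] bounds replaces sums over blocks by the sum of [s] over
    the orbit. The incomplete blocks at both ends have total length less than
    [2 * N] and are counted twice: once for [b], once for [s]. *)
Lemma cocycle_average N (s : T -> R) C n x : (0 < N)%N -> 0 <= C ->
  (forall y, b 1%N y <= expR C) -> (forall y, b N y <= expR (N%:R * s y)) ->
  (forall y, - C <= s y) -> 1 <= b n x ->
  - (4 * N%:R * C) <= \sum_(k < n) s (iter k f x).
Proof.
move=> N0 C0 bC bs sC bn.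
have [nN|Nn] := ltnP n N.
  have : - (n%:R * C) <= \sum_(k < n) s (iter k f x).
    rewrite -mulrN mulr_natl -[n in _ *+ n]card_ord -sumr_const.
    by apply: ler_sum => k _; exact: sC.
  apply: le_trans; rewrite lerN2 ler_wpM2r//.
  have : n%:R <= N%:R :> R by rewrite ler_nat ltnW.
  have : 0 <= N%:R :> R by [].
  lra.
pose q := (n %/ N).-1.
have qE : (n %/ N = q.+1)%N by rewrite prednK// divn_gt0.
have nE : n = (q * N + (N + n %% N))%N.
  by rewrite {1}(divn_eq n N) qE mulSn addnCA addnA addnC.
have rN := ltn_pmod n N0.
set r := (n %% N)%N in nE rN.
have H (i : 'I_N) : - (2 * C) <= \sum_(j < q) s (iter (j * N) f (iter i f x)).
  have E : n = ((N + r - i) + (q * N + i))%N.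
    have iN : (i <= N + r)%N by rewrite (leq_trans (ltnW (ltn_ord i)))// leq_addr.
    by rewrite addnCA subnK.
  have : b n x <= expR ((N + r)%:R * C) *
      expR (N%:R * \sum_(j < q) s (iter (j * N) f (iter i f x))).
    rewrite {1}E; apply: le_trans (bD _ _ _) _.
    have -> : ((N + r)%:R : R) = (N + r - i)%:R + i%:R.
      by rewrite -natrD subnK// (leq_trans (ltnW (ltn_ord i)))// leq_addr.
    rewrite mulrDl expRD -mulrA; apply: ler_pM => //; first exact: cocycle_expR_le.
    rewrite mulrC; apply: le_trans (bD _ _ _) _.
    by apply: ler_pM => //; [exact: cocycle_block_le|exact: cocycle_expR_le].
  move=> /(le_trans bn); rewrite -expRD -[X in X <= _]expR0 ler_expR => H.
  have N0' : 0 < N%:R :> R by rewrite ltr0n.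
  have rN' : (N + r)%:R <= 2 * N%:R :> R.
    by rewrite natrD; have : r%:R <= N%:R :> R; [rewrite ler_nat ltnW|lra].
  have : (N + r)%:R * C <= 2 * N%:R * C by rewrite ler_wpM2r.
  move: H; set S := \sum_(_ < _) _ => H1 H2.
  by rewrite -(ler_pM2l N0'); lra.
have HS : - (2 * N%:R * C) <= \sum_(k < q * N) s (iter k f x).
  rewrite -sum_blocks.
  have -> : - (2 * N%:R * C) = \sum_(i < N) (- (2 * C)) :> R.
    by rewrite sumr_const card_ord -mulr_natl; lra.
  by apply: ler_sum => i _; exact: H.
rewrite -(big_mkord xpredT (fun k => s (iter k f x))) nE big_mkord big_split_ord/=.
have HT : - (2 * N%:R * C) <= \sum_(k < N + r) s (iter (q * N + k) f x).
  apply: (@le_trans _ _ (\sum_(k < N + r) (- C))); last by apply: ler_sum => k _; exact: sC.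
  rewrite sumr_const card_ord -[(- C) *+ _]mulr_natl mulrN lerN2 ler_wpM2r//.
  by rewrite natrD; have : r%:R <= N%:R :> R; [rewrite ler_nat ltnW|lra].
have -> : - (4 * N%:R * C) = - (2 * N%:R * C) + - (2 * N%:R * C) by lra.
exact: lerD.
Qed.

End Cocycle.

Section NegativeGrowth.
Variables (R : realType) (T : ptopologicalType) (f : T -> T) (b : nat -> T -> R).
Hypotheses (hT : hausdorff_space T) (cT : compact [set: T]) (cf : continuous f).
Hypothesis b_ge0 : forall n x, 0 <= b n x.
Hypothesis b0 : forall x, b 0%N x <= 1.
Hypothesis bD : forall n m x, b (n + m) x <= b n (iter m f x) * b m x.
Hypothesis b_usc : forall n a, open [set x | b n x < a].

Lemma usc_bounded n : exists2 C, 0 <= C & forall x, b n x <= expR C.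
Proof.
have := cT; rewrite compact_cover => /(_ _ setT (fun k : nat => [set x | b n x < expR k%:R])).
have oU (k : nat) : setT k -> open [set x | b n x < expR k%:R] by move=> _; exact: b_usc.
move=> /(_ oU)[|D _ HD].
  move=> x _; exists (Num.truncn (b n x)).+1 => //=.
  apply: lt_le_trans (truncnS_gt _) _.
  by apply: le_trans (expR_ge1Dx _); rewrite lerDr.
exists (\max_(i <- finmap.enum_fset D) i)%:R => // x.
have [i /= iD bi] := HD x I; apply: ltW; apply: lt_le_trans bi _.
by rewrite ler_expR ler_nat; apply: (@leq_bigmax_seq _ _ xpredT id).
Qed.

Hypothesis b_chi : forall mu : probability (borel T) R, invariant_measure f mu ->
  {ae mu, forall x, let u n := ((n%:R^-1)%:E * lne (b n x)%:E)%E in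
     cvgn u /\ (limn u < 0)%E}.

(** Points with growth rate at most [- a] from time [1 / a] on fill the space
    as [a] decreases to 0. Hence [a] is first chosen so that they have
    probability more than one half; only then is the time [N] chosen, large
    enough that the derivative is less than 1 outside a set of probability less
    than [e * a]. *)
Lemma exists_block (P : probability (borel T) R) (e : R) : invariant_measure f P -> 0 < e ->
  exists2 a : R, 0 < a & exists N, [/\ (0 < N)%N,
    ((2^-1)%:E < P [set x | (b N x < expR (N%:R * - a))%R])%E &
    ((1 - e * a)%:E < P [set x | (b N x < 1)%R])%E].
Proof.
move=> fP e0.
pose L n a := [set x : borel T | b n x < expR (n%:R * a)].
pose H j : set (borel T) := \bigcap_(n in [set n | (j < n)%N]) L n (- j.+1%:R^-1).
have mL n a : measurable (L n a) by apply: sub_sigma_algebra; exact: b_usc.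
have mH j : measurable (H j) by apply: bigcap_measurable => //; exists j.+1 => /=.
have mUH : measurable (\bigcup_j H j) by exact: bigcupT_measurable.
have ndH : {homo H : n m / (n <= m)%N >-> (n <= m)%O}.
  move=> i j ij; apply/subsetPset => x Hx n /= jn.
  apply: lt_le_trans (Hx n (leq_ltn_trans ij jn)) _.
  by rewrite ler_expR ler_wpM2l// lerN2 lef_pV2 ?posrE// ler_nat.
have PUH : P (\bigcup_j H j) = 1%E.
  have [A [mA PA0 sA]] := b_chi fP.
  have nA : ~` (\bigcup_j H j) `<=` A.
    move=> x nHx; apply: sA => /= -[cu lu]; apply: nHx.
    have [a a0 la] : exists2 a : R, 0 < a &
        (limn (fun n => (n%:R^-1)%:E * lne (b n x)%:E) < (- a)%:E)%E.
      move: lu; case: (limn _) => [r| |]; rewrite ?lte_fin.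
      - by move=> r0; exists (- r / 2); rewrite ?lte_fin; lra.
      - by [].
      - by move=> _; exists 1 => //; rewrite ltNyr.
    have [m _ Hm] := cvg_lt_near cu la.
    exists (maxn m (Num.truncn a^-1)) => // n; rewrite /= gtn_max => /andP[mn an].
    have n0 : (0 < n)%N by exact: leq_ltn_trans mn.
    have := lne_lt_expR n0 (Hm n (ltnW mn)).
    move=> /lt_le_trans; apply; rewrite ler_expR ler_wpM2l// lerN2.
    rewrite -[leRHS]invrK lef_pV2 ?posrE ?invr_gt0//.
    apply: le_trans (ltW (truncnS_gt _)) _.
    by rewrite ler_nat ltnS leq_maxr.
  have : P (~` (\bigcup_j H j)) = 0%E.
    apply/eqP; rewrite eq_le measure_ge0 andbT -PA0; apply: le_measure => //; rewrite inE//.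
    exact: measurableC.
  rewrite probability_setC// => PE.
  have Pfin : P (\bigcup_j H j) \is a fin_num by exact: fin_num_measure.
  move: PE; rewrite -(fineK Pfin) -EFinB => -[E].
  by congr EFin; lra.
have cP : P (H n) @[n --> \oo] --> 1%E by rewrite -PUH; exact: nondecreasing_cvg_mu.
have [j _ Hj] : \forall n \near \oo, ((2^-1)%:E < P (H n))%E.
  by apply: cvg_gt_near cP _; rewrite lte_fin invf_lt1// ltr1n.
(* [j] fixes the rate [a] before [i], which depends on it, fixes how large
   the time must be for the exceptional set to be small. *)
pose a : R := j.+1%:R^-1.
have a0 : 0 < a by rewrite invr_gt0.
have [i _ Hi] : \forall n \near \oo, ((1 - e * a)%:E < P (H n))%E.
  by apply: cvg_gt_near cP _; rewrite lte_fin gtrDl oppr_lt0 mulr_gt0.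
pose N := (maxn i j).+1.
exists a => //; exists N; split=> //.
  apply: lt_le_trans (Hj j (leqnn j)) _; apply: le_measure; rewrite ?inE//; first exact: mL.
  by move=> x; apply; rewrite /= ltnS leq_maxr.
apply: lt_le_trans (Hi i (leqnn i)) _; apply: le_measure; rewrite ?inE//.
  by apply: sub_sigma_algebra; exact: b_usc.
move=> x /(_ N); rewrite /= ltnS leq_maxl => /(_ isT) /lt_le_trans; apply.
by rewrite -[leRHS]expR0 ler_expR mulrN oppr_le0 mulr_ge0.
Qed.

(** The norm of the derivative may be as large as [expR (N * C)] on the
    exceptional set, of probability less than [e * a]; taking [e] small compared with
    [1 / C] makes this loss smaller than the gain [a / 2]. *)
Lemma negative_growth_uniform : exists2 n, (0 < n)%N & forall x, b n x < 1.
Proof.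
apply: contrapT => nb.
have /choice[x bx] : forall n, exists x, (0 < n)%N -> 1 <= b n x.
  move=> [|n]; first by exists point.
  apply: contrapT => nx; apply: nb; exists n.+1 => // x.
  by rewrite ltNge; apply/negP => bx; apply: nx; exists x.
have [C C0 bC] := usc_bounded 1.
have [F [P [FP ooF fP FU]]] := @exists_invariant_limit R T f x hT cT cf.
pose e : R := (4 * (C + 1))^-1.
have e0 : 0 < e by rewrite invr_gt0; lra.
have [a a0 [N [N0 P1 P2]]] := exists_block fP e0.
pose U1 := [set y | b N y < expR (N%:R * - a)].
pose U2 := [set y | b N y < 1].
have U12 y : U1 y -> U2 y.
  move=> /lt_le_trans; apply.
  by rewrite -[leRHS]expR0 ler_expR mulrN oppr_le0 mulr_ge0// ltW.
(* [s] is [- a] on [U1], 0 on the rest of [U2] and [C] elsewhere. *)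
pose s y := C * (1 - \1_U2 y) - a * \1_U1 y.
pose D := C + a.
have bs y : b N y <= expR (N%:R * s y).
  rewrite /s !indicE.
  have [/set_mem y1|/negP y1] := boolP (y \in U1).
    have y2 : y \in U2 by apply/mem_set/U12.
    by rewrite y2 subrr mulr0 sub0r mulr1; exact: ltW.
  rewrite mulr0 subr0.
  have [/set_mem y2|y2] := boolP (y \in U2); first by rewrite subrr !mulr0 expR0; exact: ltW.
  by rewrite subr0 mulr1; exact: (cocycle_expR_le b_ge0 b0 bD).
have sD y : - D <= s y.
  have i1 : (\1_U1 y : R) = 0 \/ (\1_U1 y : R) = 1.
    by rewrite indicE; have [_|_] := boolP (y \in _); [right|left].
  have i2 : (\1_U2 y : R) = 0 \/ (\1_U2 y : R) = 1.
    by rewrite indicE; have [_|_] := boolP (y \in _); [right|left].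
  by rewrite /s /D; case: i1 => ->; case: i2 => ->; lra.
have bDx y : b 1 y <= expR D by apply: le_trans (bC y) _; rewrite ler_expR lerDl ltW.
have D0 : 0 <= D by rewrite addr_ge0// ltW.
have av n : (0 < n)%N -> - (4 * N%:R * D) <= \sum_(k < n) s (iter k f (x n)).
  by move=> n0; exact: (cocycle_average b_ge0 b0 bD N0 D0 bDx bs sD (bx n n0)).
have f1 := FU U1 _ (b_usc _ _) P1.
have f2 := FU U2 _ (b_usc _ _) P2.
(* Beyond this time the total gain [n * a / 4] exceeds the boundary term
   [4 * N * D] of [cocycle_average]. *)
have f3 : \forall n \near F, (Num.truncn (16 * N%:R * D / a) < n)%N.
  by apply: ooF; exact: nbhs_infty_gt.
have [n [[n1 n2] n3]] := filter_ex (filterI (filterI f1 f2) f3).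
have n0 : (0 < n)%N by exact: leq_ltn_trans n3.
have n0' : 0 < n%:R :> R by rewrite ltr0n.
have big_n : 16 * N%:R * D < a * n%:R.
  rewrite -ltr_pdivrMl// mulrC; apply: lt_le_trans (truncnS_gt _) _.
  by rewrite ler_nat.
have sE : \sum_(k < n) s (iter k f (x n)) =
    n%:R * (C * (1 - birkhoff_avg f \1_U2 n (x n)) - a * birkhoff_avg f \1_U1 n (x n)).
  rewrite /birkhoff_avg /s sumrB -!mulr_sumr sumrB sumr_const card_ord.
  by field; rewrite gt_eqF.
have := av n n0; rewrite sE.
move: n1 n2; set p1 := birkhoff_avg _ _ _ _; set p2 := birkhoff_avg _ _ _ _ => n1 n2.
have ee : C * e <= 4^-1.
  by rewrite /e ler_pdivrMr; lra.
have h1 : C * (1 - p2) <= C * (e * a) by rewrite ler_wpM2l//; lra.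
have h2 : C * (e * a) <= 4^-1 * a by rewrite mulrA ler_wpM2r// ltW.
have h3 : a * 2^-1 <= a * p1 by rewrite ler_wpM2l// ltW.
have h4 : C * (1 - p2) - a * p1 <= - (a / 4) by lra.
have h5 : n%:R * (C * (1 - p2) - a * p1) <= n%:R * - (a / 4) by rewrite ler_wpM2l.
move=> h6; have := le_trans h6 h5; lra.
Qed.

End NegativeGrowth.

(** * Lengths of curves under a map *)

Section Curves.
Variables (R : realType) (d : nat) (M : topologicalType).
Variables (S : smooth_structure R d M) (g : riemannian_metric S).
Implicit Types (c : chart R d M) (f h : M -> M) (gamma : R -> M).

Lemma C1_curve_at gamma c t : C1_curve S gamma -> atlas S c -> dom c (gamma t) ->
  C1_at (coord c \o gamma : R^o -> 'rV[R]_d) t.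
Proof.
move=> [cg Dg] Sc ct.
have oU : open (gamma @^-1` dom c : set R^o).
  by move/continuousP: cg; apply; exact: open_dom.
have [H _] := Ck1P (coord c \o gamma : R^o -> 'rV[R]_d) oU.
exact: (H (Dg _ Sc)).
Qed.

Lemma near_comp_curve f gamma c c' (t : R) : continuous gamma -> dom c (gamma t) ->
  \forall s \near t,
   ((coord c' \o f \o param c) \o (coord c \o gamma)) s = (coord c' \o (f \o gamma)) s.
Proof.
move=> cg ct.
have cn : \forall s \near t, dom c (gamma s) by exact: cg _ _ (near_dom ct).
by apply: filterS cn => s cs /=; rewrite coordK.
Qed.

Lemma C1_curve_comp f gamma : C1_map S f -> C1_curve S gamma -> C1_curve S (f \o gamma).
Proof.
move=> Cf Cg; have [cf _] := Cf; have [cg _] := Cg.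
have cfg : continuous (f \o gamma) by move=> t; apply: continuous_comp; [exact: cg|exact: cf].
split=> // c' Sc'; apply/Ck1P.
  by move/continuousP: cfg; apply; exact: open_dom.
move=> t c't; set c := chart_at S (gamma t).
have Sc := atlas_chart_at S (gamma t); have ct := dom_chart_at S (gamma t).
refine (eq_near_C1_at (near_comp_curve f c' cg ct) _).
have C1 := C1_curve_at Cg Sc ct.
refine (C1_at_comp C1 _).
exact: (C1_map_at Cf Sc Sc' ct c't).
Qed.

Definition velocity c gamma (t : R) : 'rV[R]_d := derive1 (coord c \o gamma) t.

Lemma velocity_comp f gamma c c' t : C1_map S f -> C1_curve S gamma ->
  atlas S c -> atlas S c' -> dom c (gamma t) -> dom c' (f (gamma t)) ->
  velocity c' (f \o gamma) t = cdiff c c' f (gamma t) (velocity c gamma t).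
Proof.
move=> Cf Cg Sc Sc' ct c't; have [cg _] := Cg.
set phi : R^o -> 'rV[R]_d := coord c \o gamma.
set psi := coord c' \o f \o param c.
have d1 : differentiable phi t := C1_at_diff (C1_curve_at Cg Sc ct).
have d2 : differentiable psi (phi t) := C1_at_diff (C1_map_at Cf Sc Sc' ct c't).
have d3 := differentiable_comp d1 d2.
have [d4 D] := eq_near_diff (near_comp_curve f c' cg ct) d3.
rewrite /velocity (derive1E' d4) (derive1E' d1).
transitivity ('d (psi \o phi) t 1); first exact: (congr1 (fun F : R -> 'rV[R]_d => F 1) D).
exact: (congr1 (fun F : R -> 'rV[R]_d => F 1) (diff_comp d1 d2)).
Qed.

(** [speed] uses at each time the chart chosen at the current point; locally it
    can be computed in a fixed chart, which makes it continuous. *)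
Lemma speedE gamma c t : C1_curve S gamma -> atlas S c -> dom c (gamma t) ->
  speed g gamma t = cnorm g c (gamma t) (velocity c gamma t).
Proof.
move=> Cg Sc ct.
have Sc' := atlas_chart_at S (gamma t); have c't := dom_chart_at S (gamma t).
have E : velocity c gamma t =
    cdiff (chart_at S (gamma t)) c id (gamma t) (velocity (chart_at S (gamma t)) gamma t).
  exact: (velocity_comp (C1_map_id S) Cg Sc' Sc c't ct).
by rewrite E cnorm_transition.
Qed.

Lemma continuous_velocity gamma c t : C1_curve S gamma -> atlas S c -> dom c (gamma t) ->
  {for t, continuous (velocity c gamma)}.
Proof.
move=> Cg Sc ct; have [_ /(_ 1) D] := C1_curve_at Cg Sc ct.
have E s : 'D_1 (coord c \o gamma : R^o -> 'rV[R]_d) s = velocity c gamma s.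
  by rewrite /velocity derive1E.
have -> : velocity c gamma = (fun s => 'D_1 (coord c \o gamma : R^o -> 'rV[R]_d) s).
  by apply/funext => s; rewrite E.
exact: D.
Qed.

Lemma continuous_speed gamma : C1_curve S gamma -> continuous (speed g gamma).
Proof.
move=> Cg t; set c := chart_at S (gamma t); have [cg _] := Cg.
have Sc : atlas S c := atlas_chart_at S (gamma t).
have ct : dom c (gamma t) := dom_chart_at S (gamma t).
have cn : \forall s \near t, dom c (gamma s) by exact: cg _ _ (near_dom ct).
have E : \forall s \near t, cnorm g c (gamma s) (velocity c gamma s) = speed g gamma s.
  by apply: filterS cn => s cs; rewrite (speedE Cg Sc cs).
refine (eq_near_continuous E _).
exact: (@continuous_cnorm _ _ _ _ g _ gamma (velocity c gamma) c t Sc ct (cg t)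
  (continuous_velocity Cg Sc ct)).
Qed.

Lemma integrable_speed gamma : C1_curve S gamma ->
  lebesgue_measure.-integrable `[0, 1] (EFin \o speed g gamma).
Proof.
move=> Cg; apply: continuous_compact_integrable; first exact: segment_compact.
by apply: continuous_subspaceT => t; exact: continuous_speed.
Qed.

Lemma speed_ge0 gamma t : 0 <= speed g gamma t.
Proof. exact: sqrtr_ge0. Qed.

Lemma curve_length_ge0 gamma : 0 <= curve_length g gamma.
Proof. by apply: Rintegral_ge0 => t _; exact: speed_ge0. Qed.

Lemma speed_comp_le f gamma t : C1_map S f -> C1_curve S gamma ->
  speed g (f \o gamma) t <= op_norm g f (gamma t) * speed g gamma t.
Proof.
move=> Cf Cg; apply: le_trans (tangent_map_le _ _ _ Cf).
rewrite le_eqVlt; apply/orP; left; apply/eqP.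
congr (tangent_norm g _ _); apply: (@velocity_comp f gamma _ _ t Cf Cg) => //;
  do ?[exact: atlas_chart_at|exact: dom_chart_at].
Qed.

Lemma curve_length_comp_le f gamma k : C1_map S f -> C1_curve S gamma ->
  (forall x, op_norm g f x <= k) ->
  curve_length g (f \o gamma) <= k * curve_length g gamma.
Proof.
move=> Cf Cg fk; rewrite /curve_length -RintegralZl//; last exact: integrable_speed.
apply: le_Rintegral => //; first exact: integrable_speed (C1_curve_comp Cf Cg).
  have -> : EFin \o (fun x => k * speed g gamma x) =
      (fun x => k%:E * (EFin \o speed g gamma) x)%E by [].
  by apply: integrableZl => //; exact: integrable_speed.
move=> t _; apply: le_trans (speed_comp_le _ Cf Cg) _.
by apply: ler_wpM2r => //; exact: speed_ge0.
Qed.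

Lemma piecewise_C1_ge0 p q l : piecewise_C1 g p q l -> 0 <= l.
Proof. by elim=> // gamma q' l' _ _ l0; rewrite addr_ge0// curve_length_ge0. Qed.

Lemma piecewise_C1_comp f k p q l : C1_map S f -> (forall x, op_norm g f x <= k) ->
  piecewise_C1 g p q l -> exists2 l', piecewise_C1 g (f p) (f q) l' & l' <= k * l.
Proof.
move=> Cf fk; elim=> [p'|gamma q' l' Cg _ [l2 P2 H2]].
  by exists 0; [exact: piecewise_C1_refl|rewrite mulr0].
exists (curve_length g (f \o gamma) + l2).
  exact: (piecewise_C1_cons (C1_curve_comp Cf Cg) P2).
by rewrite mulrDr lerD// curve_length_comp_le.
Qed.

Lemma has_lbound_piecewise p q : has_lbound [set l | piecewise_C1 g p q l].
Proof. by exists 0 => l; exact: piecewise_C1_ge0. Qed.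

Lemma dist_ge0 p q : (exists l, piecewise_C1 g p q l) -> 0 <= dist g p q.
Proof. by move=> ne; apply: lb_le_inf => // l; exact: piecewise_C1_ge0. Qed.

Lemma dist_comp_le f k p q : C1_map S f -> 0 < k -> (forall x, op_norm g f x <= k) ->
  (exists l, piecewise_C1 g p q l) -> dist g (f p) (f q) <= k * dist g p q.
Proof.
move=> Cf k0 fk ne; rewrite -ler_pdivrMl//; apply: lb_le_inf => // l Pl.
rewrite ler_pdivrMl//; have [l' Pl' l'l] := piecewise_C1_comp Cf fk Pl.
by apply: le_trans l'l; apply: ge_inf => //; exact: has_lbound_piecewise.
Qed.

End Curves.

(** * Joining points by curves *)

Section Connectivity.
Variables (R : realType) (d : nat) (M : topologicalType).
Variables (S : smooth_structure R d M) (g : riemannian_metric S).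
Implicit Types (c : chart R d M).

Lemma C1_at_real (s ds : R -> R) (t : R) : (forall t : R, is_derive t 1 s (ds t)) ->
  continuous ds -> C1_at (s : R^o -> R^o) t.
Proof.
move=> Ds cds.
have dif (u : R) : differentiable (s : R^o -> R^o) u.
  by apply/derivable1_diffP; case: (Ds u).
split; first by near=> u; exact: dif.
move=> w.
have E u : 'D_w (s : R^o -> R^o) u = w * ds u.
  rewrite (deriveE _ (dif u)) -[w in LHS]mulr1 [LHS]linearZ/= -(deriveE _ (dif u)).
  by have [_ ->] := Ds u.
rewrite (_ : (fun y => _) = fun u => w * ds u); last by apply/funext.
exact: (cvgM (cvg_cst w) (cds t)).
Unshelve. all: by end_near. Qed.

Lemma differentiable_segment (V W : normedModType R) (k : V -> R^o) (y v : W) (u : V) :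
  differentiable k u -> differentiable (fun z => y + k z *: v) u /\
  'd (fun z => y + k z *: v) u = (fun w => 'd k u w *: v) :> (V -> W).
Proof.
move=> dk; have d0 := @differentiable_cst R V W y u; have d1 := differentiableZl v dk.
split; first exact: (differentiableD d0 d1).
apply: (etrans (diffD d0 d1)); rewrite diff_cst diffZl//.
by apply/funext => w; exact: add0r.
Qed.

Lemma C1_at_segment (V W : normedModType R) (k : V -> R^o) (y v : W) (u : V) : C1_at k u ->
  C1_at (fun z => y + k z *: v) u.
Proof.
move=> [ds Ds]; split; first by apply: filterS ds => z /(differentiable_segment y v)[].
move=> w.
have E : \forall z \near u, 'D_w k z *: v = 'D_w (fun z => y + k z *: v) z.
  apply: filterS ds => z dz; have [d1 D1] := differentiable_segment y v dz.
  by rewrite (deriveE _ dz) (deriveE _ d1) D1.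
refine (eq_near_continuous E _).
exact: (cvgZr_tmp (Ds w)).
Qed.

(** A straight segment in a chart must be parametrized by the whole real line
    without leaving the chart. A parametrization [s] with values in the
    interval from -1 to 1 is allowed because balls are symmetric. *)
Lemma C1_curve_segment c y v r (s : R -> R) : atlas S c ->
  (forall z, `|y - z| < r -> dom c (param c z) /\ coord c (param c z) = z) ->
  `|v| < r -> (forall t, `|s t| <= 1) -> (forall t, C1_at (s : R^o -> R^o) t) ->
  C1_curve S (fun t => param c (y + s t *: v)).
Proof.
move=> Sc Hr vr s1 Cs.
pose w (t : R^o) := y + s t *: v.
have Cw t : C1_at w t by exact: C1_at_segment.
have Hw t : dom c (param c (w t)) /\ coord c (param c (w t)) = w t.
  apply: Hr; rewrite /w opprD addNKr normrN normrZ.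
  by apply: le_lt_trans vr; rewrite ler_piMl.
have cg : continuous (fun t => param c (w t)).
  move=> t; have [ct wE] := Hw t.
  have cp := continuous_param ct; rewrite wE in cp.
  exact: (@continuous_comp _ _ _ w (param c) t (C1_at_continuous (Cw t)) cp).
split=> // c' Sc'; apply/Ck1P.
  by move/continuousP: cg; apply; exact: open_dom.
move=> t /= c't; have [ct wE] := Hw t.
have C2 := C1_map_at (C1_map_id S) Sc Sc' ct c't.
rewrite wE in C2.
exact: (C1_at_comp (Cw t) C2).
Qed.

Lemma piecewise_C1_trans p q r l l' : piecewise_C1 g p q l -> piecewise_C1 g q r l' ->
  piecewise_C1 g p r (l + l').
Proof.
elim=> [q'|gamma q' l2 Cg _ IH] H; first by rewrite add0r.
by rewrite -addrA; apply: piecewise_C1_cons => //; exact: IH.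
Qed.

Lemma curve_piecewise_C1 gamma p q : C1_curve S gamma -> gamma 0 = p -> gamma 1 = q ->
  exists l, piecewise_C1 g p q l.
Proof.
move=> Cg <- <-; exists (curve_length g gamma + 0).
by apply: piecewise_C1_cons => //; exact: piecewise_C1_refl.
Qed.

(** The functions [t |-> sin (pi / 2 * t)] and [t |-> cos (pi / 2 * t)] take
    the values 0 and 1, in either order, at the times 0 and 1 and stay in the
    interval from -1 to 1, so they parametrize the segment in both
    directions. *)
Lemma near_piecewise_C1 p : \forall q \near p,
  (exists l, piecewise_C1 g p q l) /\ (exists l, piecewise_C1 g q p l).
Proof.
set c := chart_at S p.
have Sc : atlas S c by exact: atlas_chart_at.
have cp : dom c p by exact: dom_chart_at.
have /nbhs_ballP[r /= r0 Hr] := near_param cp.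
have {}Hr z : `|coord c p - z| < r -> dom c (param c z) /\ coord c (param c z) = z.
  by move=> zr; apply: Hr; rewrite -ball_normE.
have nq : \forall q \near p, `|coord c p - coord c q| < r.
  have := continuous_coord cp; rewrite /prop_for /continuous_at.
  by move=> /cvgrPdist_lt/(_ r r0).
have cq := near_dom cp.
near=> q.
have dq : dom c q by near: q.
have qr : `|coord c p - coord c q| < r by near: q.
pose v := coord c q - coord c p.
have vr : `|v| < r by rewrite distrC.
have E0 : param c (coord c p + 0 *: v) = p by rewrite scale0r addr0 coordK.
have E1 : param c (coord c p + 1 *: v) = q by rewrite scale1r /v addrC subrK coordK.
have pis0 : sin (pi / 2 * 0 : R) = 0 by rewrite mulr0 sin0.
have pis1 : sin (pi / 2 * 1 : R) = 1 by rewrite mulr1 sin_pihalf.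
have pic0 : cos (pi / 2 * 0 : R) = 1 by rewrite mulr0 cos0.
have pic1 : cos (pi / 2 * 1 : R) = 0 by rewrite mulr1 cos_pihalf.
have Dl (t : R) : is_derive t 1 (fun t : R => pi / 2 * t) (pi / 2).
  by rewrite -[X in is_derive _ _ _ X]mulr1; exact: is_deriveZ.
split.
- apply: (@curve_piecewise_C1 (fun t => param c (coord c p + sin (pi / 2 * t) *: v))).
  + apply: (C1_curve_segment Sc Hr vr) => t; first by rewrite ler_norml sin_geN1 sin_le1.
    apply: (@C1_at_real _ (fun t => cos (pi / 2 * t) * (pi / 2))).
    move=> u; apply: cvgM; last exact: cvg_cst.
    apply: continuous_comp; last exact: continuous_cos.
    exact: mulrl_continuous.
  + by rewrite pis0 E0.
  + by rewrite pis1 E1.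
- apply: (@curve_piecewise_C1 (fun t => param c (coord c p + cos (pi / 2 * t) *: v))).
  + apply: (C1_curve_segment Sc Hr vr) => t; first by rewrite ler_norml cos_geN1 cos_le1.
    apply: (@C1_at_real _ (fun t => - sin (pi / 2 * t) * (pi / 2))).
    move=> u; apply: cvgM; last exact: cvg_cst.
    apply: cvgN; apply: continuous_comp; last exact: continuous_sin.
    exact: mulrl_continuous.
  + by rewrite pic0 E1.
  + by rewrite pic1 E0.
Unshelve. all: by end_near. Qed.

(** Reachability from [p] is unchanged by small moves of the end point, so it
    defines a set which is both open and closed. *)
Lemma connected_piecewise_C1 : connected [set: M] ->
  forall p q, exists l, piecewise_C1 g p q l.
Proof.
move=> cM p q; pose B := [set q | exists l, piecewise_C1 g p q l].
suff BT : B = [set: M] by have : B q by rewrite BT.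
apply: cM.
- by exists p; exists 0; exact: piecewise_C1_refl.
- exists B; last by rewrite setTI.
  rewrite openE => x [l Pl]; rewrite /interior.
  apply: filterS (near_piecewise_C1 x) => y [[l' Pl'] _].
  by exists (l + l'); exact: piecewise_C1_trans Pl Pl'.
- exists B; last by rewrite setTI.
  rewrite -openC openE => x nBx; rewrite /interior.
  apply: filterS (near_piecewise_C1 x) => y [_ [l' Pl']] [l Pl].
  by apply: nBx; exists (l + l'); exact: piecewise_C1_trans Pl Pl'.
Qed.

End Connectivity.

(** * A bump function along curves *)

(** Turns a pointwise comparison with the speed of a curve, taken as [s], into a
    comparison with its length. *)
Lemma le_increment_Rintegral (R : realType) (F s : R -> R) (C : R) :
  (forall t, derivable F t 1) -> continuous (F^`()%classic) ->
  lebesgue_measure.-integrable `[0, 1] (EFin \o s) ->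
  (forall t, `|F^`()%classic t| <= C * s t) ->
  `|F 1 - F 0| <= C * Rintegral lebesgue_measure `[0, 1] s.
Proof.
move=> dF cF' ints FC.
have cF (t : R) : {for t, continuous F}.
  by apply: differentiable_continuous; exact/derivable1_diffP.
have cF'01 : {within `[0, 1], continuous F^`()%classic} by exact: continuous_subspaceT.
have iF' : lebesgue_measure.-integrable `[0, 1] (EFin \o F^`()%classic).
  by apply: continuous_compact_integrable => //; exact: segment_compact.
have E : F 1 - F 0 = Rintegral lebesgue_measure `[0, 1] F^`()%classic.
  rewrite /Rintegral (@continuous_FTC2 _ F^`()%classic F)//.
  split; first by move=> t _; exact: dF.
    by apply: cvg_at_right_filter; exact: cF.
  by apply: cvg_at_left_filter; exact: cF.
rewrite E; apply: le_trans (le_normr_Rintegral _ iF') _ => //.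
rewrite -RintegralZl//; apply: le_Rintegral => //.
- exact: integrable_norm.
- have -> : EFin \o (fun x => C * s x) = (fun x => C%:E * (EFin \o s) x)%E by [].
  exact: integrableZl.
Qed.

(** The square of the positive part is C1, although the positive part is not
    differentiable at 0; it truncates the bump function. *)
Lemma is_derive_sqr_pos (R : realType) (t : R) :
  is_derive t 1 (fun s : R => Num.max 0 s ^+ 2) (2 * Num.max 0 t).
Proof.
have [t0|t0|<-] := ltgtP 0 t.
- have E : \forall s \near t, s ^+ 2 = Num.max 0 s ^+ 2.
    by near=> s; rewrite max_r//; near: s; apply: filterS (lt_nbhsr t0) => s /ltW.
  apply: near_eq_is_derive E _.
  have := @is_deriveX R R id 2 t 1 1 (is_derive_id t 1).
  by move=> /is_derive_eq; apply; rewrite expr1; exact: mulr1.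
- have E : \forall s \near t, 0 = Num.max 0 s ^+ 2.
    by near=> s; rewrite max_l ?expr0n//; near: s; apply: filterS (lt_nbhsl t0) => s /ltW.
  apply: near_eq_is_derive E _.
  by rewrite mulr0; exact: is_derive_cst.
- apply/is_derive1_caratheodory; exists (Num.max 0); split.
  + move=> z; rewrite maxxx expr0n subr0 subr0 expr2.
    by have [z0|z0] := leP 0 z; rewrite ?mulr0 ?mul0r.
  + have : continuous (fun z : R => Num.max 0 z).
      by move=> z; apply: continuous_max; [exact: cvg_cst|exact: cvg_id].
    exact.
  + by rewrite maxxx mulr0.
Unshelve. all: by end_near. Qed.

(** The Euclidean distance is used because its square is smooth, unlike the
    sup norm of row vectors. *)
Definition sqdist (R : realType) d (y z : 'rV[R]_d) : R := \sum_i (z 0 i - y 0 i) ^+ 2.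

Lemma is_derive_sqdist (R : realType) d (y : 'rV[R]_d) (w : R -> 'rV[R]_d) (t : R) :
  derivable w t 1 ->
  is_derive t 1 (fun s => sqdist y (w s)) (\sum_i 2 * (w t 0 i - y 0 i) * derive1 w t 0 i).
Proof.
move=> dw; have dwi i : is_derive t 1 (fun s => w s 0 i) (derive1 w t 0 i).
  have /derivable_mxP/(_ 0 i) di := dw.
  by apply: DeriveDef => //; rewrite derive1E (derive_mx dw) mxE.
have -> : (fun s => sqdist y (w s)) = \sum_i (fun s => (w s 0 i - y 0 i) ^+ 2).
  by apply/funext => s; rewrite fct_sumE.
apply: is_derive_sum => i.
have := is_deriveX 2 (is_deriveB (dwi i) (is_derive_cst (y 0 i) t 1)).
by move=> /is_derive_eq; apply; rewrite expr1 subr0.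
Qed.

Lemma continuous_sqdist (R : realType) d (y : 'rV[R]_d) : continuous (sqdist y).
Proof.
move=> z.
have c1 i : {for z, continuous (fun z : 'rV[R]_d => z 0 i - y 0 i)}.
  exact: (cvgB (@coord_continuous _ _ _ _ _ z) (cvg_cst (y 0 i))).
have c2 i : {for z, continuous (fun z : 'rV[R]_d => (z 0 i - y 0 i) ^+ 2)}.
  exact: (cvgM (c1 i) (c1 i)).
exact: (@cvg_big R 'I_d +%R 0 xpredT add_continuous _ (nbhs z) _
  (fun i z => (z 0 i - y 0 i) ^+ 2) _ _ (fun i _ => c2 i)).
Qed.

Lemma sqdist_coord_le (R : realType) d (y z : 'rV[R]_d) i : (z 0 i - y 0 i) ^+ 2 <= sqdist y z.
Proof. by rewrite /sqdist (bigD1 i)//= lerDl sumr_ge0// => j _; exact: sqr_ge0. Qed.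

Lemma coord_norm_le (R : realType) d (v : 'rV[R]_d) i : `|v 0 i| <= `|v|.
Proof.
rewrite [leRHS]/Num.Def.normr/= mx_normrE.
exact: (le_bigmax _ (fun ij : 'I_1 * 'I_d => `|v ij.1 ij.2|) (0, i)).
Qed.

Section Bump.
Variables (R : realType) (d : nat) (M : topologicalType).
Variables (S : smooth_structure R d M) (g : riemannian_metric S).
Variables (c : chart R d M) (y : 'rV[R]_d) (rho m : R).
Hypotheses (Sc : atlas S c) (rho0 : 0 < rho) (m0 : 0 < m).

Definition bump_support : set M := [set x | dom c x /\ sqdist y (coord c x) <= rho].

Hypothesis closed_bump_support : closed bump_support.
Hypothesis norm_le : forall x v, bump_support x -> `|v| <= m * cnorm g c x v.

Definition bump_height (z : 'rV[R]_d) : R := Num.max 0 (rho - sqdist y z) ^+ 2.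

(** Positive at the points of the chart with coordinates close to [y], and zero
    away from [bump_support]. It is C1 along curves on the whole manifold as
    soon as the support is closed in the manifold. *)
Definition chart_bump (x : M) : R := if `[< dom c x >] then bump_height (coord c x) else 0.

Lemma bump_out x : ~ bump_support x -> chart_bump x = 0.
Proof.
rewrite /chart_bump; case: asboolP => // cx nx; rewrite /bump_height max_l ?expr0n//.
by rewrite subr_le0 leNgt; apply/negP => H; apply: nx; split=> //; exact: ltW.
Qed.

Let K := 4 * rho * (1 + rho) * d%:R * m.

(** At a time where the curve is in the chart, the derivative is given by the
    chain rule; at a time where it is outside the closed support, the bump
    vanishes nearby. These two cases cover all times, and on the support the
    Euclidean velocity is controlled by the speed. *)
Lemma bump_curve_aux gamma (t : R) : C1_curve S gamma ->
  [/\ derivable (chart_bump \o gamma) t 1,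
      {for t, continuous ((chart_bump \o gamma)^`()%classic)} &
      `|(chart_bump \o gamma)^`()%classic t| <= K * speed g gamma t].
Proof.
move=> Cg; have [cg _] := Cg.
have K0 : 0 <= K by rewrite /K !mulr_ge0// ?addr_ge0// ltW.
have out s : ~ bump_support (gamma s) -> is_derive s 1 (chart_bump \o gamma) 0.
  move=> ns; have ns' : \forall r \near s, ~ bump_support (gamma r).
    have nK : nbhs (gamma s) (~` bump_support).
      by apply: open_nbhs_nbhs; split=> //; exact: closed_openC.
    exact: cg _ _ nK.
  apply: (@near_eq_is_derive _ _ _ (cst 0)).
  by apply: filterS ns' => r nr; rewrite /= bump_out.
pose w := coord c \o gamma.
pose D s := - (2 * Num.max 0 (rho - sqdist y (w s)) *
  \sum_i 2 * (w s 0 i - y 0 i) * velocity c gamma s 0 i).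
have ins s : dom c (gamma s) -> is_derive s 1 (chart_bump \o gamma) (D s).
  move=> cs; have ns : \forall r \near s, dom c (gamma r) by exact: cg _ _ (near_dom cs).
  apply: (@near_eq_is_derive _ _ _ (bump_height \o w)).
    by apply: filterS ns => r cr; rewrite /= /chart_bump asboolT.
  have dw : derivable w s 1.
    exact/derivable1_diffP/(C1_at_diff (C1_curve_at Cg Sc cs)).
  have d1 := is_deriveB (is_derive_cst rho s 1) (is_derive_sqdist y dw).
  have d2 := @is_derive1_comp R (fun s => Num.max 0 s ^+ 2)
    (fun s => rho - sqdist y (w s)) s _ _ (is_derive_sqr_pos _) d1.
  by move: d2 => /is_derive_eq; apply; rewrite sub0r mulrN.
have [ct|nct] := pselect (dom c (gamma t)); last first.
  have nt : ~ bump_support (gamma t) by case.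
  have ns' : \forall r \near t, ~ bump_support (gamma r).
    have nK : nbhs (gamma t) (~` bump_support).
      by apply: open_nbhs_nbhs; split=> //; exact: closed_openC.
    exact: cg _ _ nK.
  have [d0 E0] := out t nt.
  split=> //; last by rewrite derive1E E0 normr0 mulr_ge0// speed_ge0.
  refine (@eq_near_continuous _ _ (cst 0) _ t _ _); last exact: cvg_cst.
  by apply: filterS ns' => r /out[_ E]; rewrite derive1E E.
have [dt Et] := ins t ct.
split=> //.
  have ns : \forall r \near t, dom c (gamma r) by exact: cg _ _ (near_dom ct).
  have E : \forall r \near t, D r = (chart_bump \o gamma)^`()%classic r.
    by apply: filterS ns => r /ins[_ Er]; rewrite derive1E Er.
  refine (eq_near_continuous E _).
  have cw : {for t, continuous w}.
    exact: continuous_comp (cg t) (continuous_coord ct).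
  have cv := continuous_velocity Cg Sc ct.
  have ci (q : R -> 'rV[R]_d) i : {for t, continuous q} ->
      {for t, continuous (fun s => q s 0 i)}.
    by move=> cq; exact: (@continuous_comp _ _ _ q (fun M : 'rV[R]_d => M 0 i) t cq
      (@coord_continuous _ _ _ _ _ _)).
  apply: cvgN; apply: cvgM.
    apply: cvgM; first exact: cvg_cst.
    have cq : {for t, continuous (fun s => rho - sqdist y (w s))}.
      apply: cvgB; first exact: cvg_cst.
      exact: (@continuous_comp _ _ _ w (sqdist y) t cw (@continuous_sqdist _ _ y _)).
    have cst0 : {for t, continuous (fun=> 0 : R)} by exact: cvg_cst.
    exact: (continuous_max cst0 cq).
  apply: cvg_big => [|i _]; first exact: add_continuous.
  apply: cvgM; last exact: ci cv.
  apply: cvgM; first exact: cvg_cst.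
  by apply: cvgB; [exact: ci cw|exact: cvg_cst].
have [bt|nt] := pselect (bump_support (gamma t)); last first.
  by have [_ E0] := out t nt; rewrite derive1E E0 normr0 mulr_ge0// speed_ge0.
have [_ sr] := bt.
rewrite derive1E Et /D normrN normrM.
have s0 : 0 <= sqdist y (w t) by apply: sumr_ge0 => i _; exact: sqr_ge0.
have h1 : `|2 * Num.max 0 (rho - sqdist y (w t))| <= 2 * rho.
  rewrite normrM ger0_norm// ler_wpM2l// ger0_norm ?le_max ?lexx//.
  by rewrite ge_max ltW//= gerBl.
have h2 : `|\sum_i 2 * (w t 0 i - y 0 i) * velocity c gamma t 0 i| <=
    2 * (1 + rho) * d%:R * (m * speed g gamma t).
  apply: le_trans (ler_norm_sum _ _ _) _.
  apply: (@le_trans _ _ (\sum_(i < d) 2 * (1 + rho) * (m * speed g gamma t))); last first.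
    by rewrite sumr_const card_ord -mulr_natr; lra.
  apply: ler_sum => i _; rewrite !normrM ger0_norm//.
  have A : 2 * `|w t 0 i - y 0 i| <= 2 * (1 + rho).
    rewrite ler_wpM2l//; have := le_trans (sqdist_coord_le y (w t) i) sr.
    move: (_ - _) => q q2; rewrite ler_norml; nra.
  have B : `|velocity c gamma t 0 i| <= m * speed g gamma t.
    rewrite (speedE g Cg Sc ct).
    exact: le_trans (coord_norm_le _ _) (norm_le _ bt).
  by apply: ler_pM A B => //; exact: mulr_ge0.
apply: le_trans (ler_pM _ _ h1 h2) _ => //.
rewrite /K; lra.
Qed.

Lemma bump_curve gamma : C1_curve S gamma ->
  `|chart_bump (gamma 1) - chart_bump (gamma 0)| <= K * curve_length g gamma.
Proof.
move=> Cg; apply: (@le_increment_Rintegral _ (chart_bump \o gamma)).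
- by move=> t; have [] := bump_curve_aux t Cg.
- by move=> t; have [] := bump_curve_aux t Cg.
- exact: integrable_speed.
- by move=> t; have [] := bump_curve_aux t Cg.
Qed.

Lemma bump_piecewise p q l : piecewise_C1 g p q l -> `|chart_bump q - chart_bump p| <= K * l.
Proof.
elim=> [p'|gamma q' l' Cg _ IH]; first by rewrite subrr normr0 mulr0.
rewrite -(subrKA (chart_bump (gamma 1))) addrC mulrDr (le_trans (ler_normD _ _))// lerD//.
exact: bump_curve.
Qed.

End Bump.

(** * Distinct points are at positive distance, locally uniformly *)

Section LowerBound.
Variables (R : realType) (d : nat) (M : topologicalType).
Variables (S : smooth_structure R d M) (g : riemannian_metric S).
Hypothesis hM : hausdorff_space M.

Lemma norm_le_sqdist (y z : 'rV[R]_d) (e : R) : 0 <= e ->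
  sqdist y z <= e ^+ 2 -> `|z - y| <= e.
Proof.
move=> e0 H; rewrite [leLHS]/Num.Def.normr/= mx_normrE.
apply: bigmax_le => // -[i j] _ /=; rewrite (ord1 i) !mxE.
rewrite -ler_sqr ?nnegrE// real_normK ?num_real//.
exact: le_trans (sqdist_coord_le _ _ _) H.
Qed.

(** Over a compact piece of a chart the Riemannian norm is bounded below on the
    product with the unit sphere, by its minimum. *)
Lemma compact_norm_le c (K : set 'rV[R]_d) : atlas S c -> compact K ->
  (forall z, K z -> dom c (param c z) /\ coord c (param c z) = z) ->
  exists2 m, 0 < m & forall z v, K z -> `|v| <= m * cnorm g c (param c z) v.
Proof.
move=> Sc cK Kd.
pose A := K `*` [set v : 'rV[R]_d | `|v| = 1].
have cA : compact A by apply: compact_setX => //; exact: compact_sphere.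
(* If [A] is empty and [K] is not, the unit sphere is empty and all vectors
   are zero. *)
have [A0|nA] := pselect (A !=set0); last first.
  exists 1 => // z v Kz; rewrite mul1r; have [->|v0] := eqVneq v 0.
    by rewrite normr0 cnorm_ge0.
  case: nA; exists (z, `|v|^-1 *: v); split=> //=.
  by rewrite normrZ normfV normr_id mulVf// normr_eq0.
pose F (s : 'rV[R]_d * 'rV[R]_d) := cnorm g c (param c s.1) s.2.
have cF : {within A, continuous F}.
  apply: continuous_in_subspaceT => -[z v]; rewrite inE => -[/= Kz v1].
  have [dz zE] := Kd z Kz.
  have cp : {for z, continuous (param c)} by rewrite -zE; exact: continuous_param.
  have c1 : {for (z, v), continuous (fst : 'rV[R]_d * 'rV[R]_d -> _)} by exact: cvg_fst.
  have c2 : {for (z, v), continuous (snd : 'rV[R]_d * 'rV[R]_d -> _)} by exact: cvg_snd.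
  have cps : {for (z, v), continuous (fun s : 'rV[R]_d * 'rV[R]_d => param c s.1)}.
    exact: (@continuous_comp _ _ _ fst (param c) (z, v) c1 cp).
  exact: (@continuous_cnorm _ _ _ _ g _ (fun s => param c s.1) snd c (z, v) Sc dz cps c2).
have [[z0 v0] A00 Fmin] := compact_EVT_min A0 cA cF.
move: A00; rewrite inE => -[/= Kz0 v01].
have [dz0 _] := Kd z0 Kz0.
have F0 : 0 < F (z0, v0) by apply: cnorm_gt0 => //; rewrite -normr_eq0 v01 oner_eq0.
exists (F (z0, v0))^-1; first by rewrite invr_gt0.
move=> z v Kz; apply: (@homogeneous_le _ _ Num.norm) => [k w|k w|w w1].
- exact: normrZ.
- exact: cnormZ.
- by rewrite w1 ler_pdivlMl// mulr1; apply: (Fmin (z, w)); rewrite inE.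
Qed.

(** Take a bump supported in a small compact ball around [a], away from [b]. It
    is at least [(rho / 2) ^+ 2] near [a] and vanishes near [b], and it is
    Lipschitz with respect to length. *)
Lemma piecewise_C1_lower_bound (a b : M) : a != b -> exists2 e, 0 < e &
  \forall x \near a & y \near b, forall l, piecewise_C1 g x y l -> e <= l.
Proof.
move=> ab; move: hM; rewrite open_hausdorff => /(_ _ _ ab)[[A B]] /=.
rewrite !inE => -[aA bB] [oA oB AB].
set c := chart_at S a; set y := coord c a.
have Sc : atlas S c by exact: atlas_chart_at.
have ca : dom c a by exact: dom_chart_at.
have nA : \forall z \near y, A (param c z).
  by apply: (cvg_param ca); exact: open_nbhs_nbhs.
have nAD : nbhs y [set z | (dom c (param c z) /\ coord c (param c z) = z) /\ A (param c z)].
  exact: filterI (near_param ca) nA.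
have /nbhs_ballP[e /= e0 He] := nAD.
pose rho := (e / 2) ^+ 2.
have e2 : 0 < e / 2 by rewrite divr_gt0.
have rho0 : 0 < rho by rewrite exprn_gt0.
pose K := [set z | sqdist y z <= rho].
have Kball z : K z -> ball y e z.
  move=> /(norm_le_sqdist (ltW e2)) zy; rewrite -ball_normE /= distrC.
  by apply: le_lt_trans zy _; rewrite ltr_pdivrMr// ltr_pMr// ltr1n.
have Kd z : K z -> dom c (param c z) /\ coord c (param c z) = z.
  by move=> /Kball/He[].
have KA z : K z -> A (param c z) by move=> /Kball/He[].
have cK : compact K.
  apply: bounded_closed_compact.
    exists (`|y| + e); split; first exact: num_real.
    move=> r r1 z /(norm_le_sqdist (ltW e2)) zy; apply: le_trans (ltW r1).
    rewrite -[z](subrK y) addrC (le_trans (ler_normD _ _))// lerD2l (le_trans zy)//.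
    by rewrite ler_pdivrMr// ler_peMr ?ler1n// ltW.
  have -> : K = sqdist y @^-1` [set r | r <= rho] by [].
  by apply: closed_comp; [move=> z _; exact: continuous_sqdist|exact: closed_le].
have suppE : bump_support c y rho = param c @` K.
  apply/seteqP; split=> [x [cx xr]|_ [z Kz <-]].
    by exists (coord c x); rewrite ?coordK.
  by have [dz zE] := Kd z Kz; split=> //; rewrite zE.
have clS : closed (bump_support c y rho).
  apply: compact_closed => //; rewrite suppE; apply: continuous_compact => //.
  apply: continuous_in_subspaceT => z; rewrite inE => Kz.
  by have [dz zE] := Kd z Kz; rewrite -zE; exact: continuous_param.
have [m m0 Hm] := compact_norm_le Sc cK Kd.
have nle x v : bump_support c y rho x -> `|v| <= m * cnorm g c x v.
  by rewrite suppE => -[z Kz <-]; exact: Hm.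
have BP := bump_piecewise Sc rho0 m0 clS nle.
set C := 4 * rho * _ * _ * _ in BP.
have C0 : 0 <= C by rewrite /C !mulr_ge0// ?addr_ge0// ltW.
exists ((rho / 2) ^+ 2 / (C + 1)).
  by rewrite divr_gt0 ?exprn_gt0 ?divr_gt0// ltr_wpDl.
have nb : \forall q \near b, ~ bump_support c y rho q.
  apply: filterS (open_nbhs_nbhs (conj oB bB)) => q Bq.
  rewrite suppE => -[z Kz zq]; have : (A `&` B) q by split=> //; rewrite -zq; exact: KA.
  by have := congr1 (fun F : set M => F q) AB => /= ->.
have na : \forall x \near a, sqdist y (coord c x) < rho / 2.
  have ct : {for a, continuous (sqdist y \o coord c)}.
    by apply: continuous_comp; [exact: continuous_coord|exact: continuous_sqdist].
  have s0 : (sqdist y \o coord c) a < rho / 2.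
    by rewrite /= /sqdist big1 ?divr_gt0// => i _; rewrite subrr expr0n.
  exact: (cvgr_lt _ ct _ s0).
have nda := near_dom ca.
near=> x q => l Pl.
have xd : dom c x by near: x.
have xs : sqdist y (coord c x) < rho / 2 by near: x.
have nq : ~ bump_support c y rho q by near: q.
have l0 := piecewise_C1_ge0 Pl.
rewrite ler_pdivrMr ?ltr_wpDl//.
have := BP _ _ _ Pl; rewrite (bump_out nq) sub0r normrN.
rewrite /chart_bump asboolT// /bump_height max_r; last by rewrite subr_ge0; lra.
rewrite ger0_norm ?sqr_ge0// => H.
apply: (@le_trans _ _ ((rho - sqdist y (coord c x)) ^+ 2)).
  by rewrite ler_sqr ?nnegrE; lra.
by apply: le_trans H _; rewrite mulrC ler_wpM2l// lerDl.
Unshelve. all: by end_near. Qed.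

End LowerBound.

(** * Dynamics of a map with a contracting iterate *)

Section ContractingDynamics.
Variables (R : realType) (T : ptopologicalType) (D : T -> T -> R).
Hypothesis cT : compact [set: T].
Hypothesis D_ge0 : forall x y, 0 <= D x y.
Hypothesis D_sep : forall a b : T, a != b -> exists2 e, 0 < e &
  \forall x \near a & y \near b, e <= D x y.

Lemma D_gt0 a b : a != b -> 0 < D a b.
Proof.
move=> /D_sep[e e0 He]; apply: lt_le_trans e0 _.
have [[A B] [/= nA nB] AB] := He.
by apply: (AB (a, b)); split; exact: nbhs_singleton.
Qed.

(** Convergence in distance implies convergence in the topology: by [D_sep], no
    other point is a cluster point, and a compact space provides one. *)
Lemma cluster_set1 (u : nat -> T) p : D (u n) p @[n --> \oo] --> 0 ->
  cluster (u n @[n --> \oo]) = [set p].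
Proof.
move=> up; have sub : cluster (u n @[n --> \oo]) `<=` [set p].
  move=> q uq; apply: contrapT => /eqP /D_sep[e e0 [[A B] [/= nA nB] AB]].
  have small : \forall n \near \oo, D (u n) p < e by exact: (cvgr_lt _ up _ e0).
  have FA : (u n @[n --> \oo]) (u @` [set n | D (u n) p < e]).
    by apply: filterS small => n un; exists n.
  have [_ [[n /= un <-] Aun]] := uq _ A FA nA.
  have := AB (u n, p) (conj Aun (nbhs_singleton nB)).
  by rewrite /= leNgt un.
apply/seteqP; split=> // _ ->.
have [q [_ uq]] : [set: T] `&` cluster (u n @[n --> \oo]) !=set0.
  by apply: cT; exact: filterT.
by rewrite -(sub _ uq).
Qed.

Variables (f : T -> T) (N : nat) (k : R).
Hypotheses (cf : continuous f) (N0 : (0 < N)%N) (k0 : 0 <= k) (k1 : k < 1).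
Hypothesis Df : forall x y, D (iter N f x) (iter N f y) <= k * D x y.

Lemma D_iter_le n x y : D (iter n (iter N f) x) (iter n (iter N f) y) <= k ^+ n * D x y.
Proof.
elim: n => [|n IH]; first by rewrite expr0 mul1r.
by apply: le_trans (Df _ _) _; rewrite exprS -mulrA ler_wpM2l.
Qed.

Lemma cvg_geom (a : R) : k ^+ n * a @[n --> \oo] --> 0.
Proof.
rewrite -(mul0r a); apply: cvgMr_tmp; apply: cvg_expr.
by rewrite ger0_norm.
Qed.

Lemma fixpoint_eq p q : iter N f p = p -> iter N f q = q -> p = q.
Proof.
move=> Fp Fq; apply: contrapT => /eqP /D_gt0 Dpq.
have := Df p q; rewrite Fp Fq leNgt => /negP; apply.
by rewrite gtr_pMl.
Qed.

(** Successive points of an orbit of the contraction get close in distance. If a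
    cluster point [p] differed from its image, then [D_sep] and continuity at
    [p] would keep [iter n h] and its image apart infinitely often. *)
Lemma exists_fixpoint : exists p, f p = p.
Proof.
pose h := iter N f.
have ch : continuous h.
  have ci n : continuous (iter n f).
    by elim: n => [|n IH] x; [exact: cvg_id|apply: continuous_comp; [exact: IH|exact: cf]].
  exact: ci.
pose u n := iter n h point.
have [p [_ up]] : [set: T] `&` cluster (u n @[n --> \oo]) !=set0.
  by apply: cT; exact: filterT.
(* [f p] is another fixed point of [h], hence equal to [p]. *)
suff hp : h p = p.
  by exists p; apply: fixpoint_eq => //; rewrite -iterSr iterS -[iter N f p]/(h p) hp.
apply: contrapT => /eqP; rewrite eq_sym => /D_sep[e e0 [[A B] [/= nA nB] AB]].
have small : \forall n \near \oo, k ^+ n * D point (h point) < e.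
  exact: (cvgr_lt _ (cvg_geom _) _ e0).
have nAB : nbhs p (A `&` h @^-1` B) by apply: filterI => //; exact: ch.
have FA : (u n @[n --> \oo]) (u @` [set n | k ^+ n * D point (h point) < e]).
  by apply: filterS small => n un; exists n.
have [_ [[n /= un <-] [Aun Bun]]] := up _ _ FA nAB.
have := AB (u n, h (u n)) (conj Aun Bun); rewrite /= leNgt => /negP; apply.
have -> : h (u n) = iter n h (h point) by rewrite -iterSr.
exact: le_lt_trans (D_iter_le _ _ _) un.
Qed.

(** Euclidean division of the time by [N] reduces to the iterates of the
    contraction, started from one of [N] points. *)
Lemma cvg_orbit p x : f p = p -> D (iter n f x) p @[n --> \oo] --> 0.
Proof.
move=> fp; have itp n : iter n f p = p by elim: n => //= n ->.
pose a := \sum_(r < N) D (iter r f x) p.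
have bound n : D (iter n f x) p <= k ^+ (n %/ N) * a.
  have -> : D (iter n f x) p =
      D (iter (n %/ N) (iter N f) (iter (n %% N) f x)) (iter (n %/ N) (iter N f) p).
    by rewrite -!iterM itp -iterD -divn_eq.
  apply: le_trans (D_iter_le _ _ _) _; rewrite ler_wpM2l ?exprn_ge0//.
  by rewrite /a (bigD1 (Ordinal (ltn_pmod n N0)))//= lerDl sumr_ge0.
apply/cvgr0Pnorm_lt => e e0.
have [m _ Hm] : \forall m \near \oo, k ^+ m * a < e by exact: (cvgr_lt _ (cvg_geom a) _ e0).
exists (m * N)%N => // n /= mn; rewrite ger0_norm//.
by apply: le_lt_trans (bound n) (Hm _ _); rewrite /= leq_divRL.
Qed.

End ContractingDynamics.

Section IteratesOfMap.
Variables (R : realType) (d : nat) (M : ptopologicalType).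
Variables (S : smooth_structure R d M) (g : riemannian_metric S) (f : M -> M).
Hypothesis fC1 : C1_map S f.

Lemma op_norm_id_le x : op_norm g id x <= 1.
Proof.
apply: op_norm_le => //; first exact: C1_map_id.
move=> v; rewrite mul1r le_eqVlt; apply/orP; left; apply/eqP.
by apply: cnorm_transition; do ?[exact: atlas_chart_at|exact: dom_chart_at].
Qed.

Lemma op_norm_iterD n m x :
  op_norm g (iter (n + m) f) x <= op_norm g (iter n f) (iter m f x) * op_norm g (iter m f) x.
Proof.
have -> : iter (n + m) f = iter n f \o iter m f by apply/funext => y; rewrite iterD.
by apply: op_norm_comp; exact: C1_map_iter.
Qed.

Lemma open_op_norm_lt h a : C1_map S h -> open [set x | op_norm g h x < a].
Proof. by move=> Ch; rewrite openE => x /= xa; exact: near_op_norm_lt. Qed.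

Lemma op_norm_lt1_uniform h : compact [set: M] -> C1_map S h ->
  (forall x, op_norm g h x < 1) -> exists k, [/\ 0 < k, k < 1 & forall x, op_norm g h x <= k].
Proof.
move=> cM Ch h1.
have := cM; rewrite compact_cover => /(_ _ setT
  (fun n : nat => [set x | op_norm g h x < 1 - n.+2%:R^-1])).
have oU (n : nat) : setT n -> open [set x | op_norm g h x < 1 - n.+2%:R^-1].
  by move=> _; exact: open_op_norm_lt.
move=> /(_ oU)[|A _ HA].
  move=> x _; exists (Num.truncn (1 - op_norm g h x)^-1) => //=.
  have p0 : 0 < 1 - op_norm g h x by rewrite subr_gt0.
  rewrite ltrBrDl -ltrBrDr -[ltRHS]invrK ltf_pV2 ?posrE ?invr_gt0//.
  by apply: lt_trans (truncnS_gt _) _; rewrite ltr_nat.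
pose n := (\max_(i <- finmap.enum_fset A) i)%N.
(* The shift by 2 keeps this bound positive even when [n] is 0. *)
exists (1 - n.+2%:R^-1); split.
- by rewrite subr_gt0 invf_lt1// ltr1n.
- by rewrite gtrBl invr_gt0.
- move=> x; have [i /= iA xi] := HA x I; apply: le_trans (ltW xi) _.
  rewrite lerB// lef_pV2 ?posrE// ler_nat !ltnS.
  exact: (@leq_bigmax_seq _ _ xpredT id).
Qed.

End IteratesOfMap.

Lemma orbit_fixpoint (M : topologicalType) (f : M -> M) p tau :
  (0 < tau)%N -> f p = p -> orbit f p tau = [set p].
Proof.
move=> t0 fp; have itp n : iter n f p = p by elim: n => //= n ->.
by apply/seteqP; split=> [_ [n _ <-]|_ ->]; [exact: itp|exists 0%N].
Qed.

Unset Implicit Arguments.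

Theorem theorem3 (R : realType) (d : nat) (M : ptopologicalType)
  (S : smooth_structure R d M) (g : riemannian_metric S) (f : M -> M)
  (hd : (2 <= d)%N)
  (hausdorffM : hausdorff_space M)
  (compactM : compact [set: M])
  (connectedM : connected [set: M])
  (fC1 : C1_map S f)
  (Df_gt0 : 0 < inf (range (op_norm g f)))
  (chi_lt0 : forall mu : probability (borel M) R, invariant_measure f mu ->
     {ae mu, forall x, cvgn (growth g f x) /\ (chi g f x < 0)%E}) :
  exists O : set M,
    unique (attracting_periodic_orbit g f) O /\ basin f O = [set: M].
Proof.
have [cf _] := fC1.
have Citer n : C1_map S (iter n f) by exact: C1_map_iter.
have [N N0 lt1] := @negative_growth_uniform R M f (fun n => op_norm g (iter n f))
  hausdorffM compactM cf (fun n x => op_norm_ge0 g x (Citer n)) (op_norm_id_le g)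
  (op_norm_iterD g fC1) (fun n a => open_op_norm_lt g a (Citer n)) chi_lt0.
have [k [k0 k1 kN]] := op_norm_lt1_uniform compactM (Citer N) lt1.
have ne := connected_piecewise_C1 g connectedM.
have D_ge0 x y : 0 <= dist g x y by exact: dist_ge0.
have D_sep (a b : M) : a != b -> exists2 e, 0 < e &
    \forall x \near a & y \near b, e <= dist g x y.
  move=> /(piecewise_C1_lower_bound g hausdorffM)[e e0 He]; exists e => //.
  by apply: filterS He => -[x y] /= H; exact: (lb_le_inf (ne x y) H).
have Df x y : dist g (iter N f x) (iter N f y) <= k * dist g x y by exact: dist_comp_le.
have [p fp] := exists_fixpoint compactM D_sep cf (ltW k0) k1 Df.
have itp n : iter n f p = p by elim: n => //= n ->.
have to_p x := cvg_orbit D_ge0 N0 (ltW k0) k1 Df x fp.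
exists [set p]; split; last first.
  apply/seteqP; split=> // x _; rewrite /basin/= /omega_limit.
  exact: (cluster_set1 compactM D_sep (to_p x)).
split.
  exists p, N; split=> //; last by rewrite orbit_fixpoint.
  exists setT; first exact: filterT.
  (* Attraction asks for a strict inequality between distances, hence a
     constant larger than [k]. *)
  split=> //; exists ((k + 1) / 2); split.
  - by rewrite divr_gt0// addr_gt0.
  - by rewrite midf_lt.
  - move=> q r _ _ /eqP qr; apply: le_lt_trans (Df q r) _.
    by rewrite ltr_pM2r ?midf_lt// (D_gt0 D_sep).
move=> O [p' [tau [tau0 p'tau _ ->]]].
suff -> : p' = p by rewrite orbit_fixpoint.
apply: contrapT => /eqP /(D_gt0 D_sep) D0.
have [n _ Hn] : \forall n \near \oo, dist g (iter n f p') p < dist g p' p.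
  exact: (cvgr_lt _ (to_p p') _ D0).
(* At a large multiple of its period, [p'] is back at its place, yet it must
   be closer to [p] than it is. *)
have := Hn (n * tau)%N; rewrite /= leq_pmulr// => /(_ isT).
have -> : iter (n * tau) f p' = p'.
  by rewrite iterM; elim: (n) => //= m ->.
by rewrite ltxx.
Qed.
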